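(* Let $b\in\mathbb{R}$, $\sigma\in\mathbb{R}\setminus\{0\}$, $T>0$ and $u_0\in L^1(\mathbb{R})$. Let $P_t$ and $\bar P_\tau$ be the exact and the one-step Euler-Maruyama density propagators of the Ornstein-Uhlenbeck equation $dY_t=bY_t\,dt+\sigma\,dB_t$ in $\mathbb{R}$. Then $$\lim_{n\to\infty}\ \sup_{t\in[0,T]}\ \|P_tu_0-\bar P_{t/n}^{\,n}u_0\|_{L^1(\mathbb{R})}=0.$$ If in addition either $$\int_{\mathbb{R}}|x\,u_0(x)|\,dx<\infty,\qquad\text{or}\qquad u_0\text{ is locally absolutely continuous and }\int_{\mathbb{R}}|x\,u_0'(x)|\,dx<\infty,$$ then there exist $C,N>0$, depending only on $(b,\sigma,T,u_0)$, such that for all $t\in[0,T]$ $$\|P_tu_0-\bar P_{t/n}^{\,n}u_0\|_{L^1(\mathbb{R})}\le\frac{Ct}{n}\qquad\text{for all } n\ge N.$$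
   Context: For $t>0$, $(P_tv)(y)=\int_{\mathbb{R}}k(y,x,t)v(x)\,dx$ with $$k(y,x,t)=\frac{1}{\sqrt{2\pi s(t)}}\exp\left\{-\frac{(y-xe^{bt})^2}{2s(t)}\right\},\qquad s(t)=\frac{\sigma^2}{2b}\left(e^{2bt}-1\right)$$ (interpreted as $s(t)=\sigma^2t$ when $b=0$). For $\tau>0$, $(\bar P_\tau v)(y)=\int_{\mathbb{R}}\bar k(y,x,\tau)v(x)\,dx$ with $$\bar k(y,x,\tau)=\frac{1}{\sqrt{2\pi\tau\sigma^2}}\exp\left\{-\frac{(y-(1+b\tau)x)^2}{2\tau\sigma^2}\right\}.$$ $P_0$ and $\bar P_0$ are the identity, and $\bar P_\tau^{\,n}$ is the $n$-fold composition of $\bar P_\tau$. *)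

(* Defs.v *)
From HB Require Import structures.
From mathcomp Require Import all_boot all_order all_algebra.
From mathcomp Require Import all_classical all_reals all_analysis.

Set Implicit Arguments.
Unset Strict Implicit.
Unset Printing Implicit Defensive.

Import Order.TTheory GRing.Theory Num.Theory.
Import numFieldNormedType.Exports.

Local Open Scope classical_set_scope.
Local Open Scope ring_scope.

Section OrnsteinUhlenbeck.
Variable R : realType.
Implicit Types (b sigma t tau x y : R) (v : R -> R).

Definition ou_var b sigma t : R :=
  if b == 0 then sigma ^+ 2 * t
  else sigma ^+ 2 / (2 * b) * (expR (2 * b * t) - 1).

Definition ou_kernel b sigma y x t : R :=
  (Num.sqrt (2 * pi * ou_var b sigma t))^-1 *
  expR (- ((y - x * expR (b * t)) ^+ 2 / (2 * ou_var b sigma t))).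

Definition em_kernel b sigma y x tau : R :=
  (Num.sqrt (2 * pi * tau * sigma ^+ 2))^-1 *
  expR (- ((y - (1 + b * tau) * x) ^+ 2 / (2 * tau * sigma ^+ 2))).

(* The values of [ou_propagator] and [em_propagator] at negative times carry
   no meaning. *)
Definition ou_propagator b sigma t v : R -> R :=
  if t == 0 then v
  else fun y => \int[lebesgue_measure]_x (ou_kernel b sigma y x t * v x).

Definition em_propagator b sigma tau v : R -> R :=
  if tau == 0 then v
  else fun y => \int[lebesgue_measure]_x (em_kernel b sigma y x tau * v x).

(* ||P_t u - \bar P_{t/n}^n u||_{L^1(R)} for n > 0. *)
Definition em_error b sigma (u : R -> R) t (n : nat) : \bar R :=
  ('N[@lebesgue_measure R]_1 [EFin \o
     (ou_propagator b sigma t u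
      \- iter n (em_propagator b sigma (t / n%:R)) u)%R])%E.

Definition absolutely_continuous_on (a c : R) (f : R -> R) : Prop :=
  forall e : R, 0 < e -> exists2 d : R, 0 < d &
    forall (m : nat) (l r : 'I_m -> R),
      (forall i, [/\ a <= l i, l i <= r i & r i <= c]) ->
      trivIset setT (fun i => `]l i, r i[%classic) ->
      \sum_(i < m) (r i - l i) < d ->
      \sum_(i < m) `|f (r i) - f (l i)| < e.

(* A pointwise notion: an element of L^1(R) is locally absolutely continuous
   when some representative of it satisfies this predicate. *)
Definition locally_absolutely_continuous (f : R -> R) : Prop :=
  forall a c : R, a <= c -> absolutely_continuous_on a c f.

End OrnsteinUhlenbeck.

(* Main.v *)
Require Import Defs.
From HB Require Import structures.
From mathcomp Require Import all_boot all_order all_algebra.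
From mathcomp Require Import all_classical all_reals all_analysis.
From mathcomp Require Import measurable_realfun.
From mathcomp Require Import ring lra.
Import Order.TTheory GRing.Theory Num.Theory.
Import numFieldNormedType.Exports.
Local Open Scope classical_set_scope.
Local Open Scope ring_scope.

Set Implicit Arguments.
Unset Strict Implicit.
Unset Printing Implicit Defensive.

(** Both propagators are Gaussian integral operators: the exact one transports
    a point [x] to the normal law of mean [e^(bt) x] and variance [s(t)], one
    Euler step of length [tau] to the normal law of mean [(1 + b tau) x] and
    variance [tau sigma^2]. Gaussian kernels compose explicitly
    ([gauss_op_comp]), so that [n] Euler steps of length [t/n] form a single
    Gaussian kernel, of mean [q^n x] and variance
    [(t/n) sigma^2 (1 + q^2 + ... + q^(2n-2))], where [q = 1 + bt/n]
    ([iter_em_propagatorE]). The exact variance [s(t)] is the same geometric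
    sum with [e^(bt/n)] in place of [q], up to replacing [(t/n) sigma^2] by
    [s(t/n)]. Comparing term by term, the means differ by [O(|x| t^2/n)] and
    the variances by [O(t^2/n)], whereas [s(t)] is at least of order [t]
    ([em_rates]).

    The L^1 distance of two normal densities is at most
    [3 (|v1 - v2| / v1 + |m1 - m2| / sqrt v1)] ([integral_gaussB_le], through
    the Hellinger distance), which is here [O((1 + |x|) t/n)]. Integrating
    against [|u|] gives the rate [O(t/n)] when [u] has a first moment
    ([em_error_rate_moment]). For [u] merely integrable, this bound truncated
    by the trivial bound [2] yields convergence, uniformly in [t], by dominated
    convergence ([cvg_sup_em_error]).

    If [x u'] is integrable instead, the change of variance still costs only
    [O(t/n)] times the norm of [u], and the change of mean is moved from the
    kernel to [u]: the substitution [x := m x], with [m] the ratio of the two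
    linear factors, turns it into [u - m u(m .)] ([gauss_op_dilation_le]). The
    L^1 norm of that function is controlled by Tonelli's theorem as soon as
    [|u(y) - u(x)|] is at most the integral of [|u'|] between [x] and [y].

    That last fact, for an absolutely continuous function and its pointwise
    derivative, is obtained as follows. The total variation inherits absolute
    continuity ([AC_seq_total_variation]), which makes its Stieltjes measure
    absolutely continuous with respect to Lebesgue measure
    ([stieltjes_null]); the Radon-Nikodym density is an integrand for the
    increments ([AC_density]), and the Lebesgue differentiation theorem
    identifies it with the derivative ([AC_ae_derivable]). *)

(** * Distance between Gaussian densities *)

Section gauss.
Variable R : realType.
Implicit Types (v w m x y q : R).
Notation mu := (@lebesgue_measure R).

(** Parametrised by the variance [v], not by the standard deviation: the
    composition rule is then polynomial in the parameters. *)
Definition gauss v m y : R :=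
  (Num.sqrt (2 * pi * v))^-1 * expR (- ((y - m) ^+ 2 / (2 * v))).

Lemma gauss_normal v m y : 0 < v -> gauss v m y = normal_pdf m (Num.sqrt v) y.
Proof.
move=> v0; have sv : Num.sqrt v != 0 by rewrite gt_eqF ?sqrtr_gt0.
rewrite normal_pdfE// /normal_peak /normal_fun /gauss sqr_sqrtr ?ltW//.
congr (_^-1 * expR _); first by congr Num.sqrt; rewrite -mulr_natl; ring.
by rewrite -mulNr -[v *+ 2]mulr_natl.
Qed.

Lemma gauss_ge0 v m y : 0 <= gauss v m y.
Proof. by rewrite mulr_ge0 ?expR_ge0// invr_ge0 sqrtr_ge0. Qed.

Lemma gauss_le_peak v m y : 0 < v -> gauss v m y <= (Num.sqrt (2 * pi * v))^-1.
Proof.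
move=> v0; rewrite /gauss ler_piMr ?invr_ge0 ?sqrtr_ge0//.
rewrite -[leRHS]expR0 ler_expR oppr_le0 divr_ge0 ?sqr_ge0//.
by rewrite mulr_ge0 ?ltW.
Qed.

Lemma measurable_gauss d (T : measurableType d) v (f g : T -> R) :
  measurable_fun setT f -> measurable_fun setT g ->
  measurable_fun setT (fun t => gauss v (f t) (g t)).
Proof.
move=> mf mg; apply: measurable_funM => //.
apply: measurableT_comp => //; apply: measurableT_comp => //.
by apply: measurable_funM => //; apply: measurable_funX; exact: measurable_funB.
Qed.

Lemma integral_gauss v m : 0 < v -> (\int[mu]_y (gauss v m y)%:E = 1)%E.
Proof.
move=> v0; under eq_integral do rewrite gauss_normal//.
exact: integral_normal_pdf.
Qed.

Lemma integral_Zgauss c v m : 0 <= c -> 0 < v ->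
  (\int[mu]_y (c * gauss v m y)%:E = c%:E)%E.
Proof.
move=> c0 v0; under eq_integral do rewrite EFinM.
rewrite ge0_integralZl//; first by rewrite integral_gauss ?mule1.
  by apply/measurable_EFinP; exact: measurable_gauss.
by move=> y _; rewrite lee_fin gauss_ge0.
Qed.

Lemma gauss_sym v m y : gauss v m y = gauss v y m.
Proof. by rewrite /gauss -sqrrN opprB. Qed.

(** Completing the square in [x]: the joint law of [x] and of the next position
    [y] factors into the law of [y] and the law of [x] given [y]. *)
Lemma gaussM w q y v m x : 0 < w -> 0 < v ->
  gauss w (q * x) y * gauss v m x =
  gauss (q ^+ 2 * v + w) (q * m) y *
  gauss (v * w / (q ^+ 2 * v + w)) ((w * m + q * v * y) / (q ^+ 2 * v + w)) x.
Proof.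
move=> w0 v0; have pi0 := pi_gt0 R.
have s0 : 0 < q ^+ 2 * v + w by rewrite ltr_wpDl// mulr_ge0 ?sqr_ge0 ?ltW.
have z0 : 0 < v * w / (q ^+ 2 * v + w) by rewrite divr_gt0// mulr_gt0.
rewrite /gauss mulrACA [RHS]mulrACA -!expRD -!invfM; congr (_^-1 * expR _).
  rewrite -!sqrtrM ?mulr_ge0 ?ltW//; congr Num.sqrt.
  by field; rewrite gt_eqF.
by field; rewrite !gt_eqF.
Qed.

Lemma integral_gauss_comp w q y v m : 0 < w -> 0 < v ->
  (\int[mu]_x (gauss w (q * x) y * gauss v m x)%:E =
   (gauss (q ^+ 2 * v + w) (q * m) y)%:E)%E.
Proof.
move=> w0 v0; under eq_integral do rewrite gaussM//.
rewrite integral_Zgauss ?gauss_ge0// divr_gt0 ?mulr_gt0//.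
by rewrite ltr_wpDl// mulr_ge0 ?sqr_ge0 ?ltW.
Qed.

(** Makes the geometric mean of two densities accessible: after [gaussM], it is
    a multiple of a normal density. *)
Lemma gauss_sqr v m y : 0 < v ->
  gauss v m y = 2 * Num.sqrt (2 * pi * v) * gauss (2 * v) m y ^+ 2.
Proof.
move=> v0; have pi0 := pi_gt0 R; have c0 : 0 < 2 * pi * v by rewrite !mulr_gt0.
rewrite /gauss exprMn -expRM_natl exprVn sqr_sqrtr; last first.
  by rewrite mulrA mulr_ge0 ?ltW// !mulr_gt0.
rewrite [RHS]mulrA; congr (_ * expR _); last by field; rewrite gt_eqF.
have -> : 2 * pi * (2 * v) = 2 * Num.sqrt (2 * pi * v) ^+ 2.
  by rewrite sqr_sqrtr ?ltW//; ring.
by field; rewrite gt_eqF ?sqrtr_gt0.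
Qed.

(** The middle quantity is the square of the Bhattacharyya coefficient
    [\int sqrt (p1 * p2)] of the two normal laws, in the form in which [gaussM]
    and [gauss_sqr] produce it. It equals [2 s1 s2 / (s1^2 + s2^2)] times
    [exp (- (m1 - m2)^2 / (2 (v1 + v2)))], where [si] is the square root of
    [vi]; the lower bound follows from [1 - e <= exp (- e)]. *)
Lemma bhattacharyya_ge v1 v2 m1 m2 : 0 < v1 -> 0 < v2 ->
  1 - (((v1 - v2) / v1) ^+ 2 + ((m1 - m2) / Num.sqrt v1) ^+ 2) <=
  2 * Num.sqrt (2 * pi * (v2 * v1 / (v2 + v1))) * gauss (v2 + v1) m2 m1 <= 1.
Proof.
move=> v10 v20; have pi0 := pi_gt0 R.
have v0 : 0 < v2 + v1 by rewrite addr_gt0.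
set b := 2 * _ * _.
pose s1 := Num.sqrt v1; pose s2 := Num.sqrt v2.
have s10 : 0 < s1 by rewrite sqrtr_gt0.
have s20 : 0 < s2 by rewrite sqrtr_gt0.
have v1E : v1 = s1 ^+ 2 by rewrite sqr_sqrtr ?ltW.
have v2E : v2 = s2 ^+ 2 by rewrite sqr_sqrtr ?ltW.
pose e := (m1 - m2) ^+ 2 / (2 * (v2 + v1)).
have -> : b = 2 * s1 * s2 / (v2 + v1) * expR (- e).
  rewrite /b /gauss [LHS]mulrA; congr (_ * expR _).
  have -> : 2 * pi * (v2 * v1 / (v2 + v1)) =
            (s2 * s1 / (v2 + v1)) ^+ 2 * (2 * pi * (v2 + v1)).
    by rewrite v2E v1E; field; rewrite -v2E -v1E gt_eqF.
  rewrite sqrtrM ?sqr_ge0// sqrtr_sqr ger0_norm; last first.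
    by rewrite divr_ge0 ?mulr_ge0 ?ltW.
  by field; rewrite !gt_eqF// sqrtr_gt0 !mulr_gt0.
have e0 : 0 <= e by rewrite divr_ge0 ?sqr_ge0// mulr_ge0 ?ltW.
have c0 : 0 <= 2 * s1 * s2 / (v2 + v1) by rewrite divr_ge0 ?mulr_ge0 ?ltW.
have c1 : 2 * s1 * s2 / (v2 + v1) <= 1.
  rewrite ler_pdivrMr// mul1r v1E v2E -subr_ge0.
  by rewrite (_ : _ - _ = (s1 - s2) ^+ 2) ?sqr_ge0//; ring.
apply/andP; split; last first.
  by rewrite mulr_ile1 ?expR_ge0// -[leRHS]expR0 ler_expR oppr_le0.
apply: (@le_trans _ _ (2 * s1 * s2 / (v2 + v1) * (1 - e))); last first.
  by rewrite ler_wpM2l//; apply: expR_ge1Dx.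
apply: (@le_trans _ _ (2 * s1 * s2 / (v2 + v1) - e)); last first.
  by rewrite mulrBr mulr1 lerD2l lerN2 ler_piMl.
rewrite opprD addrA; apply: lerB.
  rewrite lerBlDl -lerBlDr.
  have -> : 1 - 2 * s1 * s2 / (v2 + v1) = (s1 - s2) ^+ 2 / (v2 + v1).
    by rewrite v1E v2E; field; rewrite -v2E -v1E gt_eqF.
  rewrite ler_pdivrMr// v1E v2E.
  have -> : ((s1 ^+ 2 - s2 ^+ 2) / s1 ^+ 2) ^+ 2 * (s2 ^+ 2 + s1 ^+ 2) =
    (s1 - s2) ^+ 2 * (((s1 + s2) / s1) ^+ 2 * (1 + (s2 / s1) ^+ 2)).
    by field; rewrite gt_eqF.
  rewrite ler_peMr ?sqr_ge0// mulr_ege1//.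
    by rewrite exprn_ege1// ler_pdivlMr// mul1r lerDl ltW.
  by rewrite lerDl sqr_ge0.
rewrite exprMn exprVn sqr_sqrtr ?(ltW v10)// /e ler_wpM2l ?sqr_ge0//.
rewrite lef_pV2 ?posrE ?mulr_gt0//.
by lra.
Qed.

(** A pointwise substitute for the Cauchy-Schwarz step between the L^1 and the
    Hellinger distance: with [s], [t] the square roots of [p1], [p2], write
    [|s^2 - t^2| = |s - t| (s + t)] and apply
    [2 x y <= L x^2 + y^2 / L]. *)
Lemma abs_sub_le_AMGM (L p1 p2 r : R) : 0 < L -> 0 <= p1 -> 0 <= p2 -> 0 <= r ->
  p1 * p2 = r ^+ 2 ->
  `|p1 - p2| + L * r <= (L + L^-1) / 2 * (p1 + p2) + L^-1 * r.
Proof.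
move=> L0 p10 p20 r0 E.
pose s := Num.sqrt p1; pose t := Num.sqrt p2.
have s0 : 0 <= s := sqrtr_ge0 _; have t0 : 0 <= t := sqrtr_ge0 _.
have p1E : p1 = s ^+ 2 by rewrite sqr_sqrtr.
have p2E : p2 = t ^+ 2 by rewrite sqr_sqrtr.
have -> : r = s * t by rewrite -[r]ger0_norm// -sqrtr_sqr -E sqrtrM.
rewrite p1E p2E subr_sqr normrM (ger0_norm (addr_ge0 s0 t0)).
have := sqr_ge0 (L * `|s - t| - (s + t)).
have : `|s - t| ^+ 2 = (s - t) ^+ 2 by rewrite real_normK ?num_real.
set z := `|_| => zE; rewrite sqrrB exprMn zE => H.
rewrite -subr_ge0.
have -> : (L + L^-1) / 2 * (s ^+ 2 + t ^+ 2) + L^-1 * (s * t) -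
    (z * (s + t) + L * (s * t))
  = (L ^+ 2 * (s - t) ^+ 2 - L * z * (s + t) *+ 2 + (s + t) ^+ 2) / (2 * L).
  by field; rewrite gt_eqF.
by rewrite divr_ge0// mulr_ge0 ?ltW.
Qed.

(** Integrating [abs_sub_le_AMGM] bounds the distance by [L (1 - B) + 2 / L],
    where [B] is the Bhattacharyya coefficient. Here [1 - B <= eta^2] by
    [bhattacharyya_ge], and [L := 1 / eta] gives [3 eta]. *)
Lemma integral_gaussB_le v1 v2 m1 m2 : 0 < v1 -> 0 < v2 ->
  (\int[mu]_y (`|gauss v1 m1 y - gauss v2 m2 y|%:E) <=
   (3 * (`|v1 - v2| / v1 + `|m1 - m2| / Num.sqrt v1))%:E)%E.
Proof.
move=> v10 v20; have pi0 := pi_gt0 R.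
have v0 : 0 < v2 + v1 by rewrite addr_gt0.
have s10 : 0 < Num.sqrt v1 by rewrite sqrtr_gt0.
set eta := _ / v1 + _.
have a0 : 0 <= `|v1 - v2| / v1 by rewrite divr_ge0// ltW.
have b0 : 0 <= `|m1 - m2| / Num.sqrt v1 by rewrite divr_ge0// ltW.
have [eta0|eta0] := eqVneq eta 0.
  have := eta0; rewrite /eta => /eqP.
  rewrite paddr_eq0// !mulf_eq0 !invr_eq0 (gt_eqF v10) (gt_eqF s10) !orbF.
  rewrite !normr_eq0 !subr_eq0.
  move=> /andP[/eqP v12 /eqP m12]; rewrite v12 m12.
  rewrite !subrr normr0 !mul0r addr0 mulr0.
  by under eq_integral do rewrite subrr normr0; rewrite integral0.
have {}eta0 : 0 < eta by rewrite lt_neqAle eq_sym eta0 addr_ge0.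
pose vh := v2 * v1 / (v2 + v1); pose mh := (v1 * m2 + v2 * m1) / (v2 + v1).
have vh0 : 0 < vh by rewrite divr_gt0 ?mulr_gt0.
pose b2 := 2 * Num.sqrt (2 * pi * vh) * gauss (v2 + v1) m2 m1.
have /andP[b2_ge b2_le] := bhattacharyya_ge m1 m2 v10 v20.
rewrite -/vh -/b2 in b2_ge b2_le.
have b20 : 0 <= b2 by rewrite !mulr_ge0 ?gauss_ge0 ?sqrtr_ge0.
pose b := Num.sqrt b2; have bge0 : 0 <= b := sqrtr_ge0 _.
have bE : b ^+ 2 = b2 by rewrite sqr_sqrtr.
have ble1 : b <= 1 by rewrite -sqrtr1 ler_wsqrtr.
have prodE y : gauss v1 m1 y * gauss v2 m2 y = (b * gauss (2 * vh) mh y) ^+ 2.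
  have := @gaussM v1 1 m1 v2 m2 y v10 v20.
  rewrite expr1n !mul1r (gauss_sym v1) -/vh -/mh => ->.
  rewrite (gauss_sqr _ _ vh0) [RHS]exprMn bE /b2; ring.
(* The term in [eta^-1 * b] sits on the left so that all the integrands are
   nonnegative. *)
have ptw y : (`|gauss v1 m1 y - gauss v2 m2 y| + eta^-1 * b * gauss (2 * vh) mh y <=
   (eta^-1 + eta) / 2 * gauss v1 m1 y + (eta^-1 + eta) / 2 * gauss v2 m2 y
   + eta * b * gauss (2 * vh) mh y).
  have bg0 : 0 <= b * gauss (2 * vh) mh y by rewrite mulr_ge0 ?gauss_ge0.
  have ie0 : 0 < eta^-1 by rewrite invr_gt0.
  have := abs_sub_le_AMGM ie0 (gauss_ge0 v1 m1 y) (gauss_ge0 v2 m2 y) bg0 (prodE y).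
  by rewrite invrK mulrDr !mulrA.
have eta_ge0 := ltW eta0.
have ietage0 : 0 <= eta^-1 by rewrite invr_ge0.
have c0 : 0 <= (eta^-1 + eta) / 2 by apply: divr_ge0 => //; exact: addr_ge0.
have etab0 : 0 <= eta * b by exact: mulr_ge0.
have etavb0 : 0 <= eta^-1 * b by exact: mulr_ge0.
have vh20 : 0 < 2 * vh by rewrite mulr_gt0.
have mG v m : measurable_fun setT (fun y => gauss v m y) by exact: measurable_gauss.
have mZ c v m : measurable_fun setT (fun y => c * gauss v m y).
  exact: measurable_funM.
have mabs : measurable_fun setT (fun y => `|gauss v1 m1 y - gauss v2 m2 y|).
  by apply: measurableT_comp => //; exact: measurable_funB.
have G0 c v m y : 0 <= c -> 0 <= c * gauss v m y.
  by move=> ?; rewrite mulr_ge0// gauss_ge0.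
have : (\int[mu]_y (`|gauss v1 m1 y - gauss v2 m2 y|%:E) + (eta^-1 * b)%:E <=
   ((eta^-1 + eta) / 2)%:E + ((eta^-1 + eta) / 2)%:E + (eta * b)%:E)%E.
  rewrite -(integral_Zgauss mh etavb0 vh20) -(integral_Zgauss mh etab0 vh20).
  rewrite -{1}(integral_Zgauss m1 c0 v10) -(integral_Zgauss m2 c0 v20).
  have G0D c v m c' v' m' y : 0 <= c -> 0 <= c' ->
      (0 <= (c * gauss v m y)%:E + (c' * gauss v' m' y)%:E)%E.
    by move=> ? ?; rewrite adde_ge0// lee_fin G0.
  rewrite -!ge0_integralD//=;
    do ?[by move=> y _; first [rewrite lee_fin; exact: G0 | exact: G0D]];
    do ?[by apply/measurable_EFinP => //; first [exact: mZ |
                                apply: measurable_funD; exact: mZ]].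
  apply: ge0_le_integral => //=.
  - by move=> y _; apply: adde_ge0; rewrite lee_fin; [exact: normr_ge0|exact: G0].
  - by apply/measurable_EFinP/measurable_funD => //; exact: mZ.
  - apply/measurable_EFinP/measurable_funD; last exact: mZ.
    by apply: measurable_funD; exact: mZ.
  - by move=> y _; rewrite -!EFinD lee_fin.
rewrite -!EFinD -leeBrDr// -EFinB => /le_trans; apply; rewrite lee_fin.
have H : 1 - b <= eta ^+ 2.
  apply: (@le_trans _ _ (1 - b2)).
    by rewrite lerD2l lerN2 -bE expr2 ler_piMl.
  rewrite lerBlDr -lerBlDl (le_trans _ b2_ge)// lerD2l lerN2.
  rewrite /eta sqrrD -(real_normK (num_real ((v1 - v2) / v1))).
  rewrite -(real_normK (num_real ((m1 - m2) / Num.sqrt v1))).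
  rewrite !normrM !normfV (gtr0_norm v10) (gtr0_norm s10).
  by rewrite lerD2r lerDl mulrn_wge0// mulr_ge0.
have -> : (eta^-1 + eta) / 2 + (eta^-1 + eta) / 2 + eta * b - eta^-1 * b =
  eta^-1 * (1 - b) + eta + eta * b by field; rewrite gt_eqF.
have -> : 3 * eta = eta^-1 * eta ^+ 2 + eta + eta * 1 by field; rewrite gt_eqF.
by apply: lerD; [apply: lerD => //|]; exact: ler_wpM2l.
Qed.

End gauss.

(** * Gaussian kernel operators on L^1 *)

Lemma abse_fine_le (R : realType) (x : \bar R) : ((`|fine x|)%:E <= `|x|)%E.
Proof. by case: x => [r| |] //=; rewrite ?normr0 leey. Qed.

Lemma N1E (R : realType) (f : R -> R) :
  ('N[@lebesgue_measure R]_1 [EFin \o f] =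
   \int[@lebesgue_measure R]_x (`|f x|)%:E)%E.
Proof. by rewrite Lnorm1; apply: eq_integral. Qed.

(** Tonelli and Fubini for the kernel operator [u |-> \int k y x * u x dx] when
    the L^1 norm of [k] in [y] is at most [D x] and [D * u] is integrable. *)
Section kernel_operator.
Variable R : realType.
Notation mu := (@lebesgue_measure R).
Variables (k : R -> R -> R) (u D : R -> R).
Hypothesis mk : measurable_fun setT (fun z : R * R => k z.1 z.2).
Hypothesis mu_u : measurable_fun setT u.
Hypothesis mD : measurable_fun setT D.
Hypothesis kD : forall x, (\int[mu]_y (`|k y x|%:E) <= (D x)%:E)%E.
Hypothesis Du : (\int[mu]_x (D x * `|u x|)%:E < +oo)%E.

Let ku (z : R * R) : R := k z.1 z.2 * u z.2.

Let mku : measurable_fun setT ku.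
Proof. by apply: measurable_funM => //; exact: measurableT_comp. Qed.

Let mky x : measurable_fun setT (fun y => k y x).
Proof. exact: (measurable_fun_pair1 x mk). Qed.

Let mkux y : measurable_fun setT (fun x => k y x * u x).
Proof. exact: (measurable_fun_pair2 y mku). Qed.

Let aku : measurable_fun setT (fun z => (`|ku z|)%:E).
Proof. by apply/measurable_EFinP; exact: measurableT_comp. Qed.

Let iterated_le :
  (\int[mu]_x \int[mu]_y (`|ku (y, x)|%:E) <= \int[mu]_x (D x * `|u x|)%:E)%E.
Proof.
apply: ge0_le_integral => //=.
- by move=> x _; apply: integral_ge0 => y _; rewrite lee_fin.
- exact: (@measurable_fun_fubini_tonelli_G _ _ _ _ _ mu
    (fun z : R * R => `|ku z|%:E)).
- by apply/measurable_EFinP/measurable_funM => //; exact: measurableT_comp.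
move=> x _; rewrite EFinM.
under eq_integral do rewrite /ku/= normrM EFinM.
rewrite ge0_integralZr//; first by apply: lee_wpmul2r; [rewrite lee_fin|exact: kD].
by apply/measurable_EFinP; apply: measurableT_comp => //; exact: mky.
Qed.

Lemma integrable_kernel_mul : (mu \x mu)%E.-integrable setT (EFin \o ku).
Proof.
apply/integrable21ltyP; first exact/measurable_EFinP.
exact: le_lt_trans Du.
Qed.

Lemma integrable_kernel_operator :
  mu.-integrable setT (fun y => (\int[mu]_x (k y x * u x))%:E).
Proof.
have H := integrable_fubini_F integrable_kernel_mul.
apply: le_integrable H => //.
  apply/measurable_EFinP; apply: measurableT_comp => //.
  exact: (measurable_fubini_F integrable_kernel_mul).
by move=> y _; exact: (abse_fine_le (fubini_F mu (EFin \o ku) y)).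
Qed.

Lemma integral_kernel_operator_le :
  (\int[mu]_y (`|\int[mu]_x (k y x * u x)|%:E) <= \int[mu]_x (D x * `|u x|)%:E)%E.
Proof.
apply: le_trans iterated_le.
rewrite -(@fubini_tonelli _ _ _ _ _ mu mu (fun z : R * R => `|ku z|%:E))//.
have /measurable_int := integrable_kernel_operator.
move=> /measurable_EFinP mI.
apply: ge0_le_integral => //=.
- by apply/measurable_EFinP; exact: measurableT_comp.
- exact: (@measurable_fun_fubini_tonelli_F _ _ _ _ _ mu (fun z : R * R => `|ku z|%:E)).
move=> y _; apply: (le_trans (abse_fine_le _)).
by apply: le_abse_integral => //; apply/measurable_EFinP; exact: mkux.
Qed.

Lemma Fubini_kernel :
  (\int[mu]_y \int[mu]_x (k y x * u x)%:E = \int[mu]_x \int[mu]_y (k y x * u x)%:E)%E.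
Proof. exact: (Fubini integrable_kernel_mul). Qed.

End kernel_operator.

Section gauss_operator.
Variable R : realType.
Notation mu := (@lebesgue_measure R).
Implicit Types (a v w q tau : R) (u : R -> R).

(** The operator whose kernel transports [x] to the normal law of mean [a * x]
    and variance [v]. *)
Definition gauss_op a v u (y : R) : R := \int[mu]_x (gauss v (a * x) y * u x).

Lemma measurable_gauss_kernel a v :
  measurable_fun setT (fun z : R * R => gauss v (a * z.2) z.1).
Proof. by apply: measurable_gauss => //; exact: measurable_funM. Qed.

Lemma integral_norm_gauss v m : 0 < v -> (\int[mu]_y (`|gauss v m y|%:E) = 1)%E.
Proof.
move=> v0; under eq_integral do rewrite ger0_norm ?gauss_ge0//.
exact: integral_gauss.
Qed.

Lemma integrable_gaussM v (m : R -> R) y u : 0 < v -> measurable_fun setT m ->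
  mu.-integrable setT (EFin \o u) ->
  mu.-integrable setT (fun x => (gauss v (m x) y * u x)%:E).
Proof.
move=> v0 mm iu.
have iZ : mu.-integrable setT
    (fun x => ((Num.sqrt (2 * pi * v))^-1)%:E * (EFin \o u) x)%E.
  exact: integrableZl.
apply: le_integrable iZ => //.
  apply/measurable_EFinP/measurable_funM; first exact: measurable_gauss.
  by move/measurable_int : iu => /measurable_EFinP.
move=> x _ /=; rewrite lee_fin !normrM ler_wpM2r//.
rewrite !ger0_norm ?gauss_ge0 ?invr_ge0 ?sqrtr_ge0//.
exact: gauss_le_peak.
Qed.

Lemma integrable_norm_lty u : mu.-integrable setT (EFin \o u) ->
  (\int[mu]_x (`|u x|)%:E < +oo)%E.
Proof. by move=> /integrableP[]. Qed.

Let gauss_kernel_le a v : 0 < v ->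
  forall x, (\int[mu]_y (`|gauss v (a * x) y|%:E) <= (cst 1 x)%:E)%E.
Proof. by move=> v0 x; rewrite integral_norm_gauss. Qed.

Lemma integrable_gauss_op a v u : 0 < v -> mu.-integrable setT (EFin \o u) ->
  mu.-integrable setT (EFin \o gauss_op a v u).
Proof.
move=> v0 iu; have /integrableP[/measurable_EFinP mu_u foo] := iu.
apply: (integrable_kernel_operator (measurable_gauss_kernel a v) mu_u
  _ (gauss_kernel_le a v0)) => //.
by under eq_integral do rewrite /= mul1r.
Qed.

Lemma integral_gauss_op_le a v u : 0 < v -> mu.-integrable setT (EFin \o u) ->
  (\int[mu]_y (`|gauss_op a v u y|%:E) <= \int[mu]_x (`|u x|)%:E)%E.
Proof.
move=> v0 iu; have /integrableP[/measurable_EFinP mu_u foo] := iu.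
have E : (\int[mu]_x (cst 1 x * `|u x|)%:E = \int[mu]_x (`|u x|)%:E)%E.
  by apply: eq_integral => x _; rewrite /= mul1r.
rewrite -E; apply: (integral_kernel_operator_le (measurable_gauss_kernel a v)
  mu_u _ (gauss_kernel_le a v0)) => //.
by rewrite E.
Qed.

(** The densities of a chain of two Gaussian transitions: exchange the
    integrals and apply [integral_gauss_comp]. *)
Lemma gauss_op_comp q w a v u : 0 < w -> 0 < v ->
  mu.-integrable setT (EFin \o u) ->
  gauss_op q w (gauss_op a v u) = gauss_op (q * a) (q ^+ 2 * v + w) u.
Proof.
move=> w0 v0 iu; have /integrableP[/measurable_EFinP mu_u foo] := iu.
have s0 : 0 < q ^+ 2 * v + w by rewrite ltr_wpDl// mulr_ge0 ?sqr_ge0 ?ltW.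
apply/funext => y; rewrite /gauss_op.
pose k x z := gauss w (q * x) y * gauss v (a * z) x.
pose D z := gauss (q ^+ 2 * v + w) (q * (a * z)) y.
have k0 x z : 0 <= k x z by rewrite mulr_ge0 ?gauss_ge0.
have mk : measurable_fun setT (fun z : R * R => k z.1 z.2).
  apply: measurable_funM; last exact: measurable_gauss_kernel.
  by apply: measurable_gauss => //; exact: measurable_funM.
have mD : measurable_fun setT D.
  by apply: measurable_gauss => //; do 2 apply: measurable_funM => //.
have kE z : (\int[mu]_x (k x z)%:E = (D z)%:E)%E by exact: integral_gauss_comp.
have kD z : (\int[mu]_x (`|k x z|)%:E <= (D z)%:E)%E.
  by under eq_integral do rewrite ger0_norm//; rewrite kE.
have iDu : mu.-integrable setT (fun z => (D z * u z)%:E).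
  by apply: integrable_gaussM => //; do 2 apply: measurable_funM => //.
have Du : (\int[mu]_z (D z * `|u z|)%:E < +oo)%E.
  have /integrableP[_] := iDu; congr (_ < _)%E; apply: eq_integral => z _ /=.
  by rewrite normrM ger0_norm ?gauss_ge0.
transitivity (\int[mu]_x \int[mu]_z (k x z * u z)).
  apply: eq_Rintegral => x _; rewrite -RintegralZl//; last first.
    by apply: integrable_gaussM => //; exact: measurable_funM.
  by apply: eq_Rintegral => z _; rewrite mulrA.
transitivity (fine (\int[mu]_x \int[mu]_z (k x z * u z)%:E)).
  congr fine; apply: eq_integral => x _; rewrite fineK//.
  apply: integrable_fin_num => //.
  under eq_fun do rewrite -mulrA EFinM.
  apply: integrableZl => //.
  by apply: integrable_gaussM => //; exact: measurable_funM.
rewrite (Fubini_kernel mk mu_u mD kD Du); congr fine.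
apply: eq_integral => z _.
under eq_integral do rewrite mulrC EFinM.
rewrite integralZl//; last first.
  apply/integrableP; split.
    by apply/measurable_EFinP; exact: (measurable_fun_pair1 z mk).
  exact: le_lt_trans (kD z) (ltry _).
by rewrite kE /D -EFinM mulrC mulrA.
Qed.

Lemma iter_gauss_op q w n u : 0 < w -> mu.-integrable setT (EFin \o u) ->
  iter n.+1 (gauss_op q w) u =
  gauss_op (q ^+ n.+1) (w * \sum_(k < n.+1) (q ^+ 2) ^+ k) u.
Proof.
move=> w0 iu.
have S0 m : 0 < w * \sum_(k < m.+1) (q ^+ 2) ^+ k.
  rewrite mulr_gt0// big_ord_recl expr0 ltr_pwDl// sumr_ge0// => i _.
  by rewrite exprn_ge0 ?sqr_ge0.
elim: n => [|n ih]; first by rewrite /= big_ord1 expr1 expr0 mulr1.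
rewrite iterS ih (gauss_op_comp _ _ w0 (S0 n) iu) -exprS.
congr (gauss_op _ _ u).
rewrite [in RHS]big_ord_recl expr0 mulrDr mulr1 addrC; congr (_ + _).
rewrite mulrCA mulr_sumr; congr (_ * _); apply: eq_bigr => i _.
by rewrite -exprS.
Qed.

Lemma gauss_opB_le a1 v1 a2 v2 u (D : R -> R) : 0 < v1 -> 0 < v2 ->
  mu.-integrable setT (EFin \o u) -> measurable_fun setT D ->
  (forall x, (\int[mu]_y (`|gauss v1 (a1 * x) y - gauss v2 (a2 * x) y|%:E) <=
    (D x)%:E)%E) ->
  (\int[mu]_x (D x * `|u x|)%:E < +oo)%E ->
  (\int[mu]_y (`|gauss_op a1 v1 u y - gauss_op a2 v2 u y|%:E) <=
    \int[mu]_x (D x * `|u x|)%:E)%E.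
Proof.
move=> v10 v20 iu mD kD Du.
have /integrableP[/measurable_EFinP mu_u foo] := iu.
have mk : measurable_fun setT (fun z : R * R =>
    gauss v1 (a1 * z.2) z.1 - gauss v2 (a2 * z.2) z.1).
  by apply: measurable_funB; exact: measurable_gauss_kernel.
apply: le_trans (integral_kernel_operator_le (k := fun y x =>
  gauss v1 (a1 * x) y - gauss v2 (a2 * x) y) mk mu_u mD kD Du).
rewrite le_eqVlt; apply/orP; left; apply/eqP; apply: eq_integral => y _.
rewrite /gauss_op -RintegralB//; last 2 first.
  by apply: integrable_gaussM => //; exact: measurable_funM.
  by apply: integrable_gaussM => //; exact: measurable_funM.
by congr (`|_|%:E); apply: eq_Rintegral => x _; rewrite mulrBl.
Qed.

End gauss_operator.

(** * Rates for the Euler scheme *)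

(* [sqr_ge0] comes before [mulr_ge0], which would split [x ^+ 2] into
   [x * x] and ask for [0 <= x]. *)
Ltac nonneg := repeat first [by [] | exact: sqr_ge0 | by apply: ltW
  | exact: expR_ge0 | apply: addr_ge0 | apply: divr_ge0 | apply: mulr_ge0
  | apply: exprn_ge0 | rewrite invr_ge0].

Section propagators.
Variable R : realType.
Implicit Types (b sigma t tau : R) (u : R -> R).

Lemma ou_propagatorE b sigma t u : t != 0 ->
  ou_propagator b sigma t u = gauss_op (expR (b * t)) (ou_var b sigma t) u.
Proof.
move=> t0; apply/funext => y; rewrite /ou_propagator (negbTE t0) /gauss_op.
by apply: eq_Rintegral => x _; rewrite /ou_kernel /gauss (mulrC x).
Qed.

Lemma em_propagatorE b sigma tau u : tau != 0 ->
  em_propagator b sigma tau u = gauss_op (1 + b * tau) (tau * sigma ^+ 2) u.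
Proof.
move=> t0; apply/funext => y; rewrite /em_propagator (negbTE t0) /gauss_op.
by apply: eq_Rintegral => x _; rewrite /em_kernel /gauss !mulrA.
Qed.

(** The linear factor and the variance of the Gaussian kernel that is composed
    of [n] Euler steps of length [t / n]. *)
Definition em_factor b t n : R := (1 + b * (t / n%:R)) ^+ n.

Definition em_var b sigma t n : R :=
  t / n%:R * sigma ^+ 2 * \sum_(k < n) ((1 + b * (t / n%:R)) ^+ 2) ^+ k.

Lemma iter_em_propagatorE b sigma t n u : sigma != 0 -> 0 < t -> (0 < n)%N ->
  (@lebesgue_measure R).-integrable setT (EFin \o u) ->
  iter n (em_propagator b sigma (t / n%:R)) u =
  gauss_op (em_factor b t n) (em_var b sigma t n) u.
Proof.
move=> s0 t0 n0 iu; have tn0 : 0 < t / n%:R by rewrite divr_gt0 ?ltr0n.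
have -> : em_propagator b sigma (t / n%:R) =
    gauss_op (1 + b * (t / n%:R)) (t / n%:R * sigma ^+ 2).
  by apply/funext => v; rewrite em_propagatorE// gt_eqF.
case: n n0 tn0 => // n _ tn0; rewrite iter_gauss_op// mulr_gt0//.
by rewrite exprn_even_gt0.
Qed.

Lemma em_var_gt0 b sigma t n : sigma != 0 -> 0 < t -> (0 < n)%N ->
  0 < em_var b sigma t n.
Proof.
case: n => // n s0 t0 _; rewrite /em_var.
apply: mulr_gt0; first by rewrite mulr_gt0 ?exprn_even_gt0 ?divr_gt0 ?ltr0n.
rewrite big_ord_recl expr0.
by rewrite ltr_pwDl// sumr_ge0// => i _; rewrite exprn_ge0 ?sqr_ge0.
Qed.

Lemma normr_expR_sub1D (z : R) : `|z| <= 1 / 2 ->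
  `|expR z - (1 + z)| <= 2 * z ^+ 2.
Proof.
move=> z2; rewrite ger0_norm ?subr_ge0 ?expR_ge1Dx//.
have {}z2 : z <= 1 / 2 by apply: le_trans z2; exact: ler_norm.
have h : 0 < 1 - z by lra.
have : expR z <= (1 - z)^-1.
  rewrite -[leLHS]invrK -expRN lef_pV2 ?posrE ?expR_gt0//.
  exact: expR_ge1Dx.
move=> /le_trans /(_ _) H; rewrite lerBlDl; apply: H.
rewrite -div1r ler_pdivrMr// -subr_ge0.
have -> : (1 + z + 2 * z ^+ 2) * (1 - z) - 1 = z ^+ 2 * (1 - 2 * z) by ring.
by rewrite mulr_ge0 ?sqr_ge0//; lra.
Qed.

Lemma normr_subX_le (p q r : R) k : 0 <= p -> 0 <= q -> p <= r -> q <= r -> 1 <= r ->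
  `|p ^+ k - q ^+ k| <= k%:R * `|p - q| * r ^+ k.
Proof.
move=> p0 q0 pr qr r1; have r0 : 0 <= r by apply: le_trans r1.
elim: k => [|k ih]; first by rewrite !expr0 subrr normr0 !mul0r.
have -> : p ^+ k.+1 - q ^+ k.+1 = p * (p ^+ k - q ^+ k) + (p - q) * q ^+ k.
  by rewrite !exprS; ring.
rewrite (le_trans (ler_normD _ _))// !normrM (ger0_norm p0).
rewrite (ger0_norm (exprn_ge0 _ q0)) -natr1 mulrDl mul1r mulrDl; apply: lerD.
  rewrite exprS mulrCA; apply: ler_pM => //.
rewrite ler_wpM2l//; apply: (@le_trans _ _ (r ^+ k)).
  by rewrite lerXn2r// nnegrE.
by rewrite exprS ler_peMl// exprn_ge0.
Qed.

Lemma sqrtr_leD1 (t : R) : 0 <= t -> Num.sqrt t <= t + 1.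
Proof.
move=> t0; rewrite -{2}(sqr_sqrtr t0) -subr_ge0.
have -> : Num.sqrt t ^+ 2 + 1 - Num.sqrt t = (Num.sqrt t - 1 / 2) ^+ 2 + 3 / 4.
  by field.
by rewrite addr_ge0 ?sqr_ge0.
Qed.

(** Both signs of [b] reduce to [1 + x <= expR x] with [x = 2 |b| t], after
    factoring out [expR (2 b t)] when [b < 0]. *)
Lemma ou_var_ge b sigma T t : 0 < t -> t <= T ->
  sigma ^+ 2 * t / expR (`|b| * T) ^+ 2 <= ou_var b sigma t.
Proof.
move=> t0 tT; rewrite /ou_var -expRM_natl.
have T0 : 0 < T by exact: lt_le_trans tT.
have bT0 : 0 <= 2 * (`|b| * T) by rewrite mulr_ge0// mulr_ge0// ltW.
rewrite -expRN.
have [b0|b0] := eqVneq b 0.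
  rewrite ler_piMr ?(mulr_ge0 (sqr_ge0 sigma) (ltW t0))//.
  by rewrite -[leRHS]expR0 ler_expR oppr_le0.
rewrite -2!mulrA ler_wpM2l ?sqr_ge0//.
case: (ltgtP b 0) b0 => // {}b0 _.
  have nb0 : 0 < - 2 * b by rewrite mulNr oppr_gt0 pmulr_rlt0.
  have -> : (2 * b)^-1 * (expR (2 * b * t) - 1) =
     expR (2 * b * t) * ((expR (- 2 * b * t) - 1) / (- 2 * b)).
    rewrite !mulNr expRN; field; rewrite lt_eqF//=.
    by rewrite gt_eqF ?expR_gt0.
  rewrite (mulrC t); apply: ler_pM; rewrite ?expR_ge0 ?(ltW t0)//.
    rewrite ler_expR ltr0_norm// -subr_ge0.
    have -> : 2 * b * t - - (2 * (- b * T)) = 2 * (- b) * (T - t) by ring.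
    by rewrite mulr_ge0 ?subr_ge0// mulr_ge0// oppr_ge0 ltW.
  rewrite ler_pdivlMr// lerBrDl mulrC.
  exact: expR_ge1Dx.
have b20 : 0 < 2 * b by rewrite mulr_gt0.
apply: (@le_trans _ _ t).
  by rewrite ler_piMr ?(ltW t0)// -[leRHS]expR0 ler_expR oppr_le0.
rewrite mulrC ler_pdivlMr// lerBrDl mulrC.
exact: expR_ge1Dx.
Qed.

(** The exact flow over time [t] is [n] exact flows over time [t / n]; this puts
    its variance in the same form as [em_var]. *)
Lemma ou_var_geometric b sigma t n : (0 < n)%N ->
  ou_var b sigma t =
  \sum_(k < n) (expR (b * (t / n%:R)) ^+ 2) ^+ k * ou_var b sigma (t / n%:R).
Proof.
move=> n0; have nn0 : n%:R != 0 :> R by rewrite pnatr_eq0 -lt0n.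
rewrite -mulr_suml /ou_var; have [->|b0] := eqVneq b 0.
  rewrite mul0r expR0 expr1n.
  under eq_bigr do rewrite expr1n.
  by rewrite sumr_const card_ord; field.
rewrite mulrCA; congr (_ * _).
have -> : 2 * b * t = n%:R * (2 * (b * (t / n%:R))) by field.
have -> : 2 * b * (t / n%:R) = 2 * (b * (t / n%:R)) by ring.
by rewrite expRM_natl expRM_natl subrX1 mulrC.
Qed.

Lemma ou_var_small b sigma t : `|2 * b * t| <= 1 / 2 ->
  `|ou_var b sigma t - t * sigma ^+ 2| <= 4 * `|b| * sigma ^+ 2 * t ^+ 2.
Proof.
move=> h; rewrite /ou_var; have [->|b0] := eqVneq b 0.
  by rewrite mulrC subrr !normr0 mulr0 !mul0r.
have -> : sigma ^+ 2 / (2 * b) * (expR (2 * b * t) - 1) - t * sigma ^+ 2 =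
  sigma ^+ 2 / (2 * b) * (expR (2 * b * t) - (1 + 2 * b * t)) by field.
rewrite normrM (le_trans (ler_wpM2l _ (normr_expR_sub1D h)))//.
have -> : `|sigma ^+ 2 / (2 * b)| = sigma ^+ 2 / (2 * `|b|).
  by rewrite normrM normfV (ger0_norm (sqr_ge0 sigma)) normrM (ger0_norm (ler0n R 2)).
have -> : (2 * b * t) ^+ 2 = (2 * `|b| * t) ^+ 2.
  by rewrite !(exprMn, real_normK (num_real _)).
rewrite le_eqVlt; apply/orP; left; apply/eqP; field.
by rewrite normr_eq0.
Qed.

(** With [z = b t / n], the one-step factors [p = expR z] and [q = 1 + z]
    differ by at most [2 z^2], hence their [k]-th powers, [k <= n], by
    [O(n z^2) = O(t^2 / n)]; so do the variances, the one-step variances being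
    within [O(t^2 / n^2)] of each other. Dividing by the variance, of order
    [t], or by its square root loses at most one factor [t], which leaves
    [O(t / n)].
    The last two conclusions serve the change of variables of ratio
    [em_factor b t n / expR (b * t)]; [N] is chosen large enough for that ratio
    to be at least [1 / 2] and for [z] to be small. *)
Lemma em_rates b sigma T : sigma != 0 -> 0 < T ->
  exists (C : R) (N : nat), [/\ 0 < C, (0 < N)%N &
    forall t n, 0 < t <= T -> (N <= n)%N ->
    [/\ 0 < ou_var b sigma t,
       `|ou_var b sigma t - em_var b sigma t n| / ou_var b sigma t <= C * t / n%:R,
       `|expR (b * t) - em_factor b t n| / Num.sqrt (ou_var b sigma t) <= C * t / n%:R,
       `|em_factor b t n / expR (b * t) - 1| <= C * t / n%:R
     & 1 / 2 <= em_factor b t n / expR (b * t)]].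
Proof.
move=> s0 T0.
pose A := expR (`|b| * T); have A0 : 0 < A by exact: expR_gt0.
have A1 : 1 <= A by rewrite -[leLHS]expR0 ler_expR mulr_ge0// ltW.
pose s2 := sigma ^+ 2; have s20 : 0 < s2 by rewrite exprn_even_gt0.
have sg0 : 0 < `|sigma| by rewrite normr_gt0.
pose Ca := 2 * b ^+ 2 * A.
pose Cv := A ^+ 2 * (4 * `|b| * s2) + s2 * (4 * b ^+ 2 * A ^+ 2) * T.
have Ca0 : 0 <= Ca by rewrite /Ca; nonneg.
have Cv0 : 0 <= Cv by rewrite /Cv; nonneg.
pose C1 := Cv * A ^+ 2 / s2.
pose C2 := Ca * (T + 1) * A / `|sigma|.
pose C3 := Ca * T * A.
have C10 : 0 <= C1 by rewrite /C1; nonneg.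
have C20 : 0 <= C2 by rewrite /C2; nonneg.
have C30 : 0 <= C3 by rewrite /C3; nonneg.
pose C := C1 + C2 + C3 + 1.
have [C1C C2C C3C] : [/\ C1 <= C, C2 <= C & C3 <= C].
  by rewrite /C; clear -C10 C20 C30; split; lra.
have C0 : 0 < C by rewrite ltr_wpDl//; nonneg.
pose N := (Num.truncn (2 * C * T + 4 * `|b| * T)).+1.
exists C, N; split=> // t n /andP[t0 tT] Nn.
have n0 : (0 < n)%N by exact: leq_trans Nn.
have nn0 : 0 < n%:R :> R by rewrite ltr0n.
have nN : 2 * C * T + 4 * `|b| * T <= n%:R.
  apply: (@le_trans _ _ N%:R); last by rewrite ler_nat.
  by rewrite ltW// truncnS_gt.
pose z := b * (t / n%:R).
have tn0 : 0 <= t / n%:R by nonneg.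
have bT0 : 0 <= `|b| * T by nonneg.
have bt_le : `|b| * t <= `|b| * T by rewrite ler_wpM2l.
have zE : `|z| = `|b| * t / n%:R by rewrite normrM (ger0_norm tn0) mulrA.
have z4 : `|z| <= 1 / 4.
  rewrite zE ler_pdivrMr//.
  have : 0 <= 2 * C * T by nonneg.
  move: nN bt_le bT0; rewrite -mulrA; lra.
have z4' : `|2 * b * (t / n%:R)| <= 1 / 2.
  by rewrite -mulrA normrM -/z ger0_norm//; lra.
pose p := expR z; pose q := 1 + z; pose r := expR `|z|.
have p0 : 0 <= p by exact: expR_ge0.
have q0 : 0 <= q by rewrite /q; move: z4; rewrite ler_norml => /andP[]; lra.
have pr : p <= r by rewrite ler_expR ler_norm.
have qr : q <= r by apply: le_trans pr; exact: expR_ge1Dx.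
have r1 : 1 <= r by rewrite -[leLHS]expR0 ler_expR.
have r0 : 0 <= r by exact: le_trans r1.
have pn : p ^+ n = expR (b * t).
  by rewrite -expRM_natl; congr expR; rewrite /z; field; rewrite gt_eqF.
have rA k : (k <= n)%N -> r ^+ k <= A.
  move=> kn; apply: (@le_trans _ _ (r ^+ n)); first exact: ler_weXn2l.
  rewrite -expRM_natl ler_expR zE mulrCA divff ?mulr1 ?gt_eqF//.
have pq2 : `|p - q| <= 2 * z ^+ 2 by apply: normr_expR_sub1D; lra.
have pqk k : (k <= n)%N -> `|p ^+ k - q ^+ k| <= Ca * t ^+ 2 / n%:R.
  move=> kn; apply: le_trans (normr_subX_le k p0 q0 pr qr r1) _.
  have -> : Ca * t ^+ 2 / n%:R = n%:R * (2 * z ^+ 2) * A.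
    by rewrite /Ca /z; field; rewrite gt_eqF.
  apply: ler_pM; [by nonneg|by nonneg| |exact: rA].
  by apply: ler_pM => //; rewrite ler_nat.
have alphaE : `|expR (b * t) - em_factor b t n| <= Ca * t ^+ 2 / n%:R.
  by rewrite -pn; exact: pqk.
have v_ge := ou_var_ge b sigma t0 tT; rewrite -/A -/s2 in v_ge.
have lo0 : 0 < s2 * t / A ^+ 2.
  by apply: divr_gt0; [exact: mulr_gt0|exact: exprn_gt0].
have v0 : 0 < ou_var b sigma t by exact: lt_le_trans v_ge.
have ratioE : `|em_factor b t n / expR (b * t) - 1| <= C3 * t / n%:R.
  have -> : em_factor b t n / expR (b * t) - 1 =
     - (expR (b * t) - em_factor b t n) * expR (- (b * t)).
    by rewrite expRN; field; rewrite gt_eqF ?expR_gt0.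
  rewrite normrM normrN (ger0_norm (expR_ge0 _)).
  have -> : C3 * t / n%:R = (Ca * (T * t) / n%:R) * A.
    by rewrite /C3; field; rewrite gt_eqF.
  apply: ler_pM => //.
    apply: (le_trans alphaE); rewrite ler_pM2r ?invr_gt0// ler_wpM2l// expr2.
    by rewrite ler_wpM2r// ltW.
  rewrite ler_expR; apply: le_trans bt_le.
  by have := ler_norm (- (b * t)); rewrite normrN normrM (ger0_norm (ltW t0)).
have leC c : c <= C -> c * t / n%:R <= C * t / n%:R.
  by move=> cC; rewrite ler_pM2r ?invr_gt0// ler_pM2r.
split=> //.
- apply: le_trans (leC _ C1C).
  have H : `|ou_var b sigma t - em_var b sigma t n| <= Cv * t ^+ 2 / n%:R.
    rewrite (ou_var_geometric _ _ _ n0) /em_var mulr_sumr -sumrB.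
    apply: (le_trans (ler_norm_sum _ _ _)).
    have -> : Cv * t ^+ 2 / n%:R = \sum_(k < n) (Cv * t ^+ 2 / n%:R ^+ 2).
      by rewrite sumr_const card_ord -mulr_natr; field; rewrite gt_eqF.
    apply: ler_sum => k _; have kn := ltnW (ltn_ord k).
    rewrite -/z -/p -/q -/s2.
    have -> : (p ^+ 2) ^+ k * ou_var b sigma (t / n%:R) - t / n%:R * s2 * (q ^+ 2) ^+ k =
      (p ^+ k) ^+ 2 * (ou_var b sigma (t / n%:R) - t / n%:R * s2) +
      t / n%:R * s2 * ((p ^+ k - q ^+ k) * (p ^+ k + q ^+ k)).
      by rewrite -!exprM mulnC !exprM; ring.
    apply: (le_trans (ler_normD _ _)).
    have pkA : p ^+ k <= A by apply: le_trans (rA k kn); rewrite lerXn2r ?nnegrE.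
    have qkA : q ^+ k <= A by apply: le_trans (rA k kn); rewrite lerXn2r ?nnegrE.
    have pk0 : 0 <= p ^+ k by exact: exprn_ge0.
    have qk0 : 0 <= q ^+ k by exact: exprn_ge0.
    apply: (@le_trans _ _ (A ^+ 2 * (4 * `|b| * s2 * (t / n%:R) ^+ 2) +
        t / n%:R * s2 * (Ca * t ^+ 2 / n%:R * (2 * A)))).
      apply: lerD.
        rewrite normrM ger0_norm ?sqr_ge0//; apply: ler_pM; rewrite ?sqr_ge0//.
          by rewrite lerXn2r ?nnegrE// ltW.
        exact: ou_var_small.
      rewrite normrM (ger0_norm (mulr_ge0 tn0 (ltW s20))).
      apply: ler_wpM2l; first exact: mulr_ge0 tn0 (ltW s20).
      rewrite normrM; apply: ler_pM => //; first exact: pqk.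
      by rewrite ger0_norm ?addr_ge0// mulr_natl mulr2n lerD.
    have -> : A ^+ 2 * (4 * `|b| * s2 * (t / n%:R) ^+ 2) +
        t / n%:R * s2 * (Ca * t ^+ 2 / n%:R * (2 * A)) =
       (A ^+ 2 * (4 * `|b| * s2) + s2 * (4 * b ^+ 2 * A ^+ 2) * t) * t ^+ 2 / n%:R ^+ 2.
      by rewrite /Ca; field; rewrite gt_eqF.
    rewrite ler_pM2r ?invr_gt0 ?exprn_gt0// ler_pM2r ?exprn_gt0//.
    by rewrite /Cv lerD2l ler_wpM2l//; nonneg.
  rewrite ler_pdivrMr//; apply: (le_trans H).
  have -> : Cv * t ^+ 2 / n%:R = (C1 * t / n%:R) * (s2 * t / A ^+ 2).
    by rewrite /C1; field; rewrite !gt_eqF.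
  by rewrite ler_wpM2l//; nonneg.
- apply: le_trans (leC _ C2C).
  pose st := Num.sqrt t.
  have st0 : 0 < st by rewrite sqrtr_gt0.
  have stE : t = st ^+ 2 by rewrite sqr_sqrtr ?ltW.
  have sv : `|sigma| * st / A <= Num.sqrt (ou_var b sigma t).
    have -> : `|sigma| * st / A = Num.sqrt (s2 * t / A ^+ 2).
      have -> : s2 * t / A ^+ 2 = (`|sigma| * st / A) ^+ 2.
        by rewrite !exprMn exprVn -stE real_normK ?num_real.
      by rewrite sqrtr_sqr [RHS]ger0_norm//; nonneg.
    exact: ler_wsqrtr.
  rewrite ler_pdivrMr ?sqrtr_gt0//; apply: (le_trans alphaE).
  apply: (@le_trans _ _ ((C2 * t / n%:R) * (`|sigma| * st / A))); last first.
    by rewrite ler_wpM2l//; nonneg.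
  have -> : C2 * t / n%:R * (`|sigma| * st / A) = Ca * t / n%:R * ((T + 1) * st).
    by rewrite /C2; field; rewrite !gt_eqF.
  have -> : Ca * t ^+ 2 / n%:R = Ca * t / n%:R * t by field; rewrite gt_eqF.
  apply: ler_wpM2l; first by nonneg.
  rewrite {1}stE expr2 ler_pM2r//.
  by apply: (le_trans (sqrtr_leD1 (ltW t0))); rewrite lerD2r.
- exact: le_trans (leC _ C3C).
have : C * t / n%:R <= 1 / 2.
  rewrite ler_pdivrMr//.
  have : C * t <= C * T by rewrite ler_pM2l.
  move: nN bT0; rewrite -!mulrA; clear; lra.
move: (le_trans ratioE (leC _ C3C)); rewrite ler_norml => /andP[+ _].
set x := C * t / n%:R; set y := em_factor b t n / _; clear; lra.
Qed.

End propagators.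

(** * Total variation of absolutely continuous functions *)

Section absolute_continuity.
Variable R : realType.
Implicit Types (a c x y : R) (f w : R -> R) (p q : R * R) (s : seq (R * R)).
Notation TV := total_variation.

(** For nondegenerate intervals, given by their end points, this is disjointness
    of the interiors. *)
Definition apart p q : bool := (p.2 <= q.1) || (q.2 <= p.1).

Definition subintervals a c s : bool :=
  all (fun p => [&& a <= p.1, p.1 < p.2 & p.2 <= c]) s && pairwise apart s.

(** Absolute continuity over lists of intervals in any order: lists can be
    refined by replacing one interval with a partition of it. *)
Definition AC_seq a c f := forall e : R, 0 < e -> exists2 d : R, 0 < d &
  forall s, subintervals a c s -> \sum_(p <- s) (p.2 - p.1) < d ->
  \sum_(p <- s) `|f p.2 - f p.1| <= e.

Lemma AC_seqP a c f : absolutely_continuous_on a c f -> AC_seq a c f.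
Proof.
move=> acf e e0; have [d d0 H] := acf e e0; exists d => // s /andP[sac aps] sd.
pose p0 : R * R := (0, 0); pose l (i : 'I_(size s)) := (nth p0 s i).1.
pose r (i : 'I_(size s)) := (nth p0 s i).2.
have sum_nth (G : R * R -> R) :
    \sum_(p <- s) G p = \sum_(i < size s) G (nth p0 s i).
  by rewrite (big_nth p0) big_mkord.
rewrite sum_nth; apply/ltW/(H _ l r).
- move=> i; have /allP/(_ (nth p0 s i)) := sac.
  by rewrite mem_nth// => /(_ erefl)/and3P[? /ltW ? ?].
- apply/trivIsetP => i j _ _ ij.
  wlog ltij : i j ij / (i < j)%N.
    move=> W; case: (ltngtP i j) => [/W|/W|/val_inj /eqP]; first exact.
      by rewrite eq_sym setIC; exact.
    by rewrite (negbTE ij).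
  move/(pairwiseP p0): aps => /(_ i j (ltn_ord i) (ltn_ord j) ltij).
  rewrite /apart -/(l i) -/(r i) -/(l j) -/(r j) => ap.
  apply/seteqP; split => // z /= []; rewrite !in_itv/= => /andP[z1 z2] /andP[z3 z4].
  by case/orP: ap; lra.
- by rewrite -(sum_nth (fun p => p.2 - p.1)).
Qed.

Lemma big_zip_partition (G : R -> R -> R) x (t : seq R) :
  \sum_(p <- zip (x :: t) t) G p.1 p.2 = \sum_(p <- zip t (x :: t)) G p.2 p.1.
Proof. by elim: t x => [|y t ih] x /=; rewrite ?big_nil// !big_cons /= ih. Qed.

Lemma variation_pairs x y w t : itv_partition x y t ->
  variation x y w t = \sum_(p <- zip (x :: t) t) `|w p.2 - w p.1|.
Proof.
move=> xyt; rewrite (variation_zip _ xyt).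
by rewrite (big_zip_partition (fun u v => `|w v - w u|)).
Qed.

Lemma sum_partition x y t : itv_partition x y t ->
  \sum_(p <- zip (x :: t) t) (p.2 - p.1) = y - x.
Proof.
elim: t x => [|z t ih] x /=; first by move=> /itv_partition_nil ->; rewrite big_nil subrr.
by move=> /itv_partition_cons /ih; rewrite big_cons /= => ->; rewrite addrC subrKA.
Qed.

Lemma partition_between x y t : itv_partition x y t ->
  all (fun p => [&& x <= p.1, p.1 < p.2 & p.2 <= y]) (zip (x :: t) t).
Proof.
elim: t x => [//|z t ih] x xyt.
have zyt := itv_partition_cons xyt; have zy := itv_partition_le zyt.
have xz : x < z by case: xyt => /= /andP[].
rewrite /= lexx xz zy /=; apply: sub_all (ih _ zyt) => p /and3P[zp -> ->].
by rewrite (le_trans (ltW xz)).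
Qed.

Lemma partition_apart x y t : itv_partition x y t -> pairwise apart (zip (x :: t) t).
Proof.
elim: t x => [//|z t ih] x xyt; have zyt := itv_partition_cons xyt.
have -> : zip [:: x, z & t] (z :: t) = (x, z) :: zip (z :: t) t by [].
rewrite pairwise_cons ih// andbT.
by apply: sub_all (partition_between zyt) => p /and3P[zp _ _]; rewrite /apart /= zp.
Qed.

Lemma subintervals_refine a c s1 s2 x y t : itv_partition x y t ->
  subintervals a c (s1 ++ (x, y) :: s2) ->
  subintervals a c ((s1 ++ zip (x :: t) t) ++ s2).
Proof.
move=> xyt; rewrite /subintervals !all_cat /= !pairwise_cat pairwise_cons.
rewrite allrel_consr !allrel_catl.
move=> /andP[/and3P[-> /and3P[ax xy yc] ->]].
move=> /and4P[/andP[s1xy ->] -> xys2 ->].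
have bt := partition_between xyt; rewrite (partition_apart xyt) !andbT/=.
apply/and3P; split.
- by apply: sub_all bt => p /and3P[xp -> py]; rewrite (le_trans ax)// (le_trans py).
- apply/allrelP => q p /(allP bt)/and3P[xq _ qy] ps2.
  have := allP xys2 _ ps2; rewrite /apart /= => /orP[yp|px].
    by rewrite (le_trans qy).
  by rewrite (le_trans px xq) orbT.
- apply/allrelP => p q ps1 /(allP bt)/and3P[xq _ qy].
  have := allP s1xy _ ps1; rewrite /apart /= => /orP[px|yp].
    by rewrite (le_trans px).
  by rewrite (le_trans qy yp) orbT.
Qed.

(** Replacing each interval of a family by a fine partition of it changes
    neither the total length nor disjointness, and brings the sum of the
    increments arbitrarily near the sum of the variations. The induction
    replaces one interval at a time: [s1] holds those already refined. *)
Lemma AC_seq_total_variation a c w : AC_seq a c w ->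
  forall e : R, 0 < e -> exists2 d : R, 0 < d &
  forall s, subintervals a c s -> \sum_(p <- s) (p.2 - p.1) < d ->
  (\sum_(p <- s) TV p.1 p.2 w <= e%:E)%E.
Proof.
move=> acw e e0; have [d d0 H] := acw e e0; exists d => // s sac sd.
suff gen s2 s1 : subintervals a c (s1 ++ s2) ->
    \sum_(p <- s1 ++ s2) (p.2 - p.1) < d ->
    ((\sum_(p <- s1) `|w p.2 - w p.1|)%:E + \sum_(p <- s2) TV p.1 p.2 w <= e%:E)%E.
  by have := gen s [::] sac sd; rewrite big_nil add0e.
elim: s2 s1 => [|[x y] s2 ih] s1; first by rewrite cats0 big_nil adde0 lee_fin; exact: H.
move=> s12 s12d; rewrite big_cons.
have xy : x < y.
  by move: s12; rewrite /subintervals all_cat /= => /andP[/and3P[_ /and3P[]]].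
set S := (\sum_(p <- s2) _)%E; set A := (\sum_(p <- s1) _).
have S0 : (0 <= S)%E.
  rewrite /S big_seq; apply: sume_ge0 => p ps2; apply: total_variation_ge0.
  move: s12; rewrite /subintervals all_cat /= => /andP[/and3P[_ _ /allP sA] _].
  move: (sA _ ps2).
  by move=> /and3P[_ /ltW].
have A0 : 0 <= A by apply: sumr_ge0.
have key t : itv_partition x y t ->
    (A%:E + ((variation x y w t)%:E + S) <= e%:E)%E.
  move=> xyt; have := ih (s1 ++ zip (x :: t) t) (subintervals_refine xyt s12).
  rewrite !big_cat/= (sum_partition xyt) -(variation_pairs w xyt) EFinD -addeA.
  by apply; move: s12d; rewrite big_cat big_cons /= addrA.
have AS_fin : (A%:E + S)%E \is a fin_num.
  rewrite ge0_fin_numE; last by rewrite adde_ge0// lee_fin.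
  apply: (@le_lt_trans _ _ e%:E); last exact: ltry.
  apply: le_trans (key _ (itv_partition1 xy)).
  by rewrite leeD2l// leeDr// lee_fin variation_ge0.
rewrite addeCA -leeBrDr//; apply: ge_ereal_sup => _ [_ [t xyt <-] <-].
by rewrite leeBrDr// addeCA; exact: key.
Qed.

Lemma AC_seq_small_variation a c w : AC_seq a c w ->
  forall e : R, 0 < e -> exists2 d : R, 0 < d &
  forall x y, a <= x -> x <= y -> y <= c -> y - x < d -> (TV x y w <= e%:E)%E.
Proof.
move=> acw e e0; have [d d0 H] := AC_seq_total_variation acw e0; exists d => //.
move=> x y ax; rewrite le_eqVlt => /predU1P[<- _ _|xy yc yxd].
  by rewrite total_variationxx lee_fin ltW.
have := H [:: (x, y)]; rewrite !big_seq1 /=; apply => //.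
by rewrite /subintervals /= ax xy yc.
Qed.

(** The variation is at most [1] over short intervals, and finitely many of them
    cover [[a, y]]. *)
Lemma AC_seq_total_variation_fin_num a c w : AC_seq a c w ->
  forall y, a <= y <= c -> TV a y w \is a fin_num.
Proof.
move=> acw y /andP[ay yc]; rewrite ge0_fin_numE ?total_variation_ge0//.
have [d d0 H] := AC_seq_small_variation acw ltr01.
have d20 : 0 < d / 2 by rewrite divr_gt0.
suff gen n : forall y, a <= y -> y <= c -> y - a <= n%:R * (d / 2) -> (TV a y w < +oo)%E.
  apply: (gen (Num.bound ((y - a) / (d / 2)))) => //.
  rewrite -ler_pdivrMr//; apply/ltW/archi_boundP.
  by rewrite divr_ge0 ?(ltW d20)// subr_ge0.
elim: n => [|n ih] {ay yc}y ay yc.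
  rewrite mul0r subr_le0 => ya; have -> : y = a by apply/eqP; rewrite eq_le ya ay.
  by rewrite total_variationxx ltry.
move=> yn; pose z := Num.max a (y - d / 2).
have az : a <= z by rewrite le_max lexx.
have zy : z <= y by rewrite ge_max ay gerBl ltW.
rewrite (total_variationD w az zy); apply: lte_add_pinfty.
  apply: ih => //; first exact: le_trans yc.
  have nd0 : 0 <= n%:R * (d / 2) by rewrite mulr_ge0 ?ler0n// ltW.
  move: yn; rewrite -natr1 mulrDl mul1r => yn; rewrite lerBlDr /z ge_max.
  by apply/andP; split; lra.
apply: (@le_lt_trans _ _ 1%:E); last exact: ltry.
apply: H => //; rewrite ltrBlDr -ltrBlDl /z lt_max; apply/orP; right; lra.
Qed.

End absolute_continuity.

(** * Stieltjes measure of a monotone absolutely continuous function *)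

Section stieltjes.
Variable R : realType.
Variables (a c : R) (F : R -> R).
Hypothesis ac : a < c.
Hypothesis ndF : forall x y, a <= x -> x <= y -> y <= c -> F x <= F y.
Hypothesis acF : AC_seq a c F.
Notation mu := (@lebesgue_measure R).

(* Extends [F] by constants outside [[a, c]], as a Stieltjes measure lives on
   the whole line. *)
Let clamp x := Num.max a (Num.min c x).

Let clamp_ge x : a <= clamp x.
Proof. by rewrite le_max lexx. Qed.

Let clamp_le x : clamp x <= c.
Proof. by rewrite ge_max ltW//= ge_min lexx. Qed.

Let clamp_id x : a <= x <= c -> clamp x = x.
Proof. by move=> /andP[ax xc]; rewrite /clamp (min_idPr xc) (max_idPr ax). Qed.

Let clamp_mono x y : x <= y -> clamp x <= clamp y.
Proof. by move=> xy; rewrite le_max2// le_min2. Qed.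

Let clamp_lip x y : x <= y -> clamp y - clamp x <= y - x.
Proof.
move=> xy; rewrite /clamp; have [cx|xc] := leP c x; have [cy|yc] := leP c y;
  by case: (leP a _) => ?; try case: (leP a _) => ?; lra.
Qed.

Let Fc x := F (clamp x).

Let ndFc : nondecreasing Fc.
Proof. by move=> x y xy; apply: ndF => //; exact: clamp_mono. Qed.

Let Fc_rc : right_continuous Fc.
Proof.
move=> x; apply/cvgrPdist_le => e e0; have [d d0 H] := acF e0.
near=> y; have xy : x < y by near: y; exact: nbhs_right_gt.
have yd : y - x < d.
  by rewrite ltrBlDl; near: y; apply: nbhs_right_lt; rewrite ltrDl.
have := clamp_mono (ltW xy); rewrite le_eqVlt => /predU1P[cxy|cxy].
  by rewrite /Fc cxy subrr normr0 ltW.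
have := H [:: (clamp x, clamp y)]; rewrite !big_seq1/= distrC; apply.
  by rewrite /subintervals /= clamp_ge clamp_le cxy.
exact: le_lt_trans (clamp_lip (ltW xy)) yd.
Unshelve. all: by end_near. Qed.

Let G : cumulative R R := HB.pack Fc (isCumulative.Build R _ R Fc ndFc Fc_rc).

Let m : {measure set (measurableTypeR R) -> \bar R} :=
  lebesgue_stieltjes_measure G.

Let m_itv x y : x <= y -> (m `]x, y]%classic = (Fc y - Fc x)%:E)%E.
Proof.
move=> xy; rewrite /m/= /lebesgue_stieltjes_measure /measure_extension.
by rewrite measurable_mu_extE/=; [rewrite wlength_itv_bnd|exact: is_ocitv].
Qed.

Lemma open_bounded_interval (I : set R) : open I -> is_interval I ->
  I `<=` `]a, c[ -> exists p : R * R, I = `]p.1, p.2[%classic.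
Proof.
move=> oI iI Iac; exists (inf I, sup I) => /=.
rewrite -[LHS](interior_id I).1// interval_bounded_interior//.
- by exists a => x /Iac; rewrite /= in_itv/= => /andP[/ltW].
- by exists c => x /Iac; rewrite /= in_itv/= => /andP[_ /ltW].
Qed.

Lemma itvoo_apart (p q : R * R) : p.1 < p.2 -> q.1 < q.2 ->
  `]p.1, p.2[%classic `&` `]q.1, q.2[%classic = set0 -> apart p q.
Proof.
case: p q => [p1 p2] [q1 q2] /= p12 q12 pq0; apply: contrapT => /negP.
rewrite negb_or -!ltNge /= => /andP[qp pq].
pose l := Num.max p1 q1; pose r := Num.min p2 q2.
have lr : l < r by rewrite gt_max !lt_min p12 qp pq q12.
suff : set0 ((l + r) / 2) by [].
have [h1 h2] : p1 <= l /\ q1 <= l by rewrite !le_max !lexx orbT.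
have [h3 h4] : r <= p2 /\ r <= q2 by rewrite !ge_min !lexx orbT.
by rewrite -pq0; split; rewrite /= in_itv/=; apply/andP; split; lra.
Qed.

Lemma itvoo_sub (p : R * R) : p.1 < p.2 -> `](p.1), (p.2)[ `<=` `]a, c[ ->
  a <= p.1 /\ p.2 <= c.
Proof.
case: p => l r /= lr lrac; split; rewrite leNgt; apply/negP => h.
  have lm : l < Num.min a r by rewrite lt_min h lr.
  have [h1 h2] : Num.min a r <= a /\ Num.min a r <= r by rewrite !ge_min !lexx orbT.
  have /lrac : `]l, r[%classic ((l + Num.min a r) / 2).
    by rewrite /= in_itv/=; apply/andP; split; lra.
  by rewrite /= in_itv/= => /andP[+ _]; lra.
have lm : Num.max c l < r by rewrite gt_max h lr.
have [h1 h2] : c <= Num.max c l /\ l <= Num.max c l by rewrite !le_max !lexx orbT.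
have /lrac : `]l, r[%classic ((Num.max c l + r) / 2).
  by rewrite /= in_itv/=; apply/andP; split; lra.
by rewrite /= in_itv/= => /andP[_]; lra.
Qed.

(** A null set lies in an open set of small Lebesgue measure, a countable union
    of disjoint open intervals. Over finitely many of them the total increment of
    [F] is small by absolute continuity, hence also over all of them. *)
Let stieltjes_null A : measurable A -> A `<=` `]a, c[ -> mu A = 0%E -> m A = 0%E.
Proof.
move=> mA Aac A0; apply/eqP; rewrite eq_le measure_ge0 andbT.
apply/lee_addgt0Pr => e e0; rewrite add0e.
have [d d0 Hd] := acF e0.
have A_lty : (mu A < +oo)%E by rewrite A0 ltry.
have [U0 [oU0 AU0 U0d]] := lebesgue_regularity_outer mA A_lty d0.
pose U := U0 `&` `]a, c[%classic.
have oU : open U by apply: openI => //; exact: interval_open.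
have AU : A `<=` U by move=> x Ax; split; [exact: AU0|exact: Aac].
have mU0 : measurable U0 by exact: open_measurable.
have mU : measurable U by exact: open_measurable.
have Ud : (mu U < d%:E)%E.
  apply: le_lt_trans U0d; apply: (@le_trans _ _ (mu U0)).
    by apply: le_measure; rewrite ?inE//; exact: subIsetl.
  rewrite -{1}(setDUK AU0) -[leRHS]add0e -A0.
  by apply: measureU2 => //; exact: measurableD.
apply: (@le_trans _ _ (m U)).
  by apply: le_measure; rewrite ?inE.
pose I := open_disjoint_itv oU.
have UE : U = \bigcup_q I q by exact: open_disjoint_itv_bigcup.
have tI : trivIset setT I by exact: open_disjoint_itv_trivIset.
have IU n : I n `<=` U by rewrite UE; exact: bigcup_sup.
have /boolp.choice[p pE] n : exists q, I n = `](q : R * R).1, q.2[%classic.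
  apply: open_bounded_interval.
  - exact: open_disjoint_itv_open.
  - exact: open_disjoint_itv_is_interval.
  - by move=> x /IU[].
have mI n : measurable (I n) by rewrite pE.
have := @measure_semi_sigma_additive _ _ _ m I mI tI.
rewrite -UE => /(_ mU) mUE; rewrite -(cvg_lim _ mUE)//.
apply: lime_le; first by apply/cvg_ex; exists (m U).
apply: nearW => n /=.
(* Empty components, which have [(p k).1 >= (p k).2], are left out of [s]. *)
pose P k := (p k).1 < (p k).2.
pose s := [seq p k | k <- iota 0 n & P k].
have IN k : ~~ P k -> I k = set0.
  by move=> Pk; rewrite pE set_itv_ge// bnd_simp.
have s_sub : subintervals a c s.
  apply/andP; split.
    apply/allP => q /mapP[k]; rewrite mem_filter => /andP[Pk _] ->.
    have Ik : `](p k).1, (p k).2[ `<=` `]a, c[ by rewrite -pE => x /IU[].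
    by have [? ?] := itvoo_sub Pk Ik; apply/and3P.
  rewrite pairwise_map; apply: (@sub_in_pairwise _ P (fun k l => k < l)%N); last 2 first.
  - by apply/allP => k; rewrite mem_filter => /andP[].
  - apply: pairwise_filter; rewrite -sorted_pairwise ?iota_ltn_sorted//.
    exact: ltn_trans.
  move=> k l Pk Pl kl; apply: itvoo_apart => //; rewrite -!pE.
  by move/trivIsetP: tI; apply => //; rewrite ltn_eqF.
have sum_s (g : R * R -> R) (h : nat -> \bar R) :
    (forall k, P k -> (h k = (g (p k))%:E)%E) -> (forall k, ~~ P k -> h k = 0%E) ->
    (\sum_(0 <= k < n) h k = (\sum_(q <- s) g q)%:E)%E.
  move=> hP hN; rewrite big_map big_filter -sumEFin [RHS]big_mkcond /index_iota subn0.
  apply: eq_bigr => k _; case: ifPn => [Pk|/hN//]; exact: hP.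
apply: (@le_trans _ _ (\sum_(q <- s) (F q.2 - F q.1))%:E).
  pose h k := if P k then (F (p k).2 - F (p k).1)%:E else 0%E.
  rewrite -(sum_s _ h) /h; first last.
  - by move=> k /negbTE ->.
  - by move=> k ->.
  apply: lee_sum => k _; case: ifPn => Pk; last by rewrite IN ?measure0.
  have Ik : `](p k).1, (p k).2[ `<=` `]a, c[ by rewrite -pE => x /IU[].
  have [ap pc] := itvoo_sub Pk Ik; have p12 := ltW Pk.
  have -> : F (p k).2 - F (p k).1 = Fc (p k).2 - Fc (p k).1.
    by rewrite /Fc !clamp_id ?ap ?pc ?(le_trans ap) ?(le_trans p12).
  rewrite -m_itv//; apply: le_measure.
  - by rewrite inE; exact: mI.
  - by rewrite inE; exact: measurable_itv.
  by rewrite pE => x; rewrite /= !in_itv/= => /andP[-> /ltW ->].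
rewrite lee_fin; apply: le_trans (Hd s s_sub _).
  by apply: ler_sum => q _; exact: ler_norm.
rewrite -lte_fin -(sum_s (fun q => q.2 - q.1) (mu \o I)).
- apply: le_lt_trans Ud; rewrite UE.
  rewrite big_mkord -measure_bigsetU//; apply: le_measure.
  - by rewrite inE; apply: bigsetU_measurable => i _; exact: mI.
  - by rewrite inE; apply: bigcup_measurable => i _; exact: mI.
  - exact: bigsetU_bigcup.
- by move=> k Pk /=; rewrite pE lebesgue_measure_itv/= lte_fin ifT.
- by move=> k /IN /= ->; rewrite measure0.
Qed.

Let m_lty : (m `]a, c[%classic < +oo)%E.
Proof.
apply: (@le_lt_trans _ _ (m `]a, c]%classic)); last by rewrite m_itv ?ltry// ltW.
apply: le_measure; rewrite ?inE; first exact: measurable_itv.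
  exact: measurable_itv.
exact: subset_itv_oo_oc.
Qed.

(** The density is the Radon-Nikodym derivative of the Stieltjes measure of [F],
    restricted to the open interval so as to be finite. *)
Lemma monotone_AC_density : exists f : R -> R,
  mu.-integrable setT (EFin \o f) /\
  forall x y, a < x -> x <= y -> y < c ->
    ((F y - F x)%:E = \int[mu]_(t in `]x, y]) (f t)%:E)%E.
Proof.
have mac : measurable (`]a, c[%classic : set (measurableTypeR R)).
  exact: measurable_itv.
pose nu : {finite_measure set (measurableTypeR R) -> \bar R} := mfrestr mac m_lty.
have numu : nu `<< mu.
  apply/null_content_dominatesP => A mA A0; rewrite /nu/= /mfrestr /mrestr.
  apply: stieltjes_null; first exact: measurableI.
    exact: subIsetr.
  apply/eqP; rewrite -measure_le0 -A0; apply: le_measure.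
  - by rewrite inE; exact: measurableI.
  - by rewrite inE.
  - exact: subIsetl.
have [f [f0 ffin intf nuE]] := radon_nikodym_sigma_finite numu.
exists (fine \o f); split.
  by apply: eq_integrable intf => // x _ /=; rewrite fineK.
move=> x y ax xy yc.
transitivity (nu `]x, y]%classic).
  rewrite /nu/= /mfrestr /mrestr setIidl; last first.
    move=> z; rewrite /= !in_itv/= => /andP[xz zy].
    by rewrite (lt_trans ax xz) (le_lt_trans zy yc).
  rewrite m_itv// /Fc !clamp_id// ?(ltW (lt_le_trans ax xy)) ?(ltW yc)//.
  by rewrite (ltW ax) (le_trans xy (ltW yc)).
rewrite nuE; last exact: measurable_itv.
by apply: eq_integral => z _; rewrite /= fineK.
Qed.

End stieltjes.

(** * The fundamental theorem of calculus for absolutely continuous functions *)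

Section AC_derivative.
Variable R : realType.
Implicit Types (a c x y : R) (w f : R -> R).
Notation mu := (@lebesgue_measure R).
Notation TV := total_variation.

(** Jordan decomposition: [w] is the difference of the nondecreasing functions
    [V] and [V - w], where [V] is the total variation from [a]; both are
    absolutely continuous because [V] is. *)
Lemma AC_density a c w : a < c -> absolutely_continuous_on a c w ->
  exists f, mu.-integrable setT (EFin \o f) /\
  forall x y, a < x -> x <= y -> y < c ->
    ((w y - w x)%:E = \int[mu]_(t in `]x, y]) (f t)%:E)%E.
Proof.
move=> ac /AC_seqP acw; pose V x := fine (TV a x w).
have TVfin x : a <= x <= c -> TV a x w \is a fin_num.
  exact: AC_seq_total_variation_fin_num.
have VB x y : a <= x -> x <= y -> y <= c -> ((V y - V x)%:E = TV x y w)%E.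
  move=> ax xy yc.
  have fx : TV a x w \is a fin_num by rewrite TVfin// ax (le_trans xy).
  have fy : TV a y w \is a fin_num by rewrite TVfin// yc (le_trans ax).
  by rewrite EFinB !fineK// (total_variationD w ax xy) addeAC subee// add0e.
have wV x y : a <= x -> x <= y -> y <= c -> `|w y - w x| <= V y - V x.
  by move=> ax xy yc; rewrite -lee_fin VB//; exact: total_variation_ge.
have V_ge0 x y : a <= x -> x <= y -> y <= c -> 0 <= V y - V x.
  by move=> ax xy yc; apply: le_trans (wV x y _ _ _).
have VAC e : 0 < e -> exists2 d : R, 0 < d & forall s, subintervals a c s ->
    \sum_(p <- s) (p.2 - p.1) < d -> \sum_(p <- s) (V p.2 - V p.1) <= e.
  move=> e0; have [d d0 H] := AC_seq_total_variation acw e0; exists d => // s ss sd.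
  rewrite -lee_fin; apply: le_trans (H s ss sd).
  rewrite -sumEFin big_seq [leRHS]big_seq; apply: lee_sum => p ps.
  move: ss => /andP[/allP/(_ _ ps)/and3P[ap /ltW pp pc] _].
  by rewrite VB.
have [f1 [if1 f1E]] : exists f, mu.-integrable setT (EFin \o f) /\
    forall x y, a < x -> x <= y -> y < c ->
    ((V y - V x)%:E = \int[mu]_(t in `]x, y]) (f t)%:E)%E.
  apply: (monotone_AC_density ac).
    by move=> x y ax xy yc; rewrite -subr_ge0; exact: V_ge0.
  move=> e e0; have [d d0 H] := VAC e e0; exists d => // s ss sd.
  apply: le_trans (H s ss sd); rewrite big_seq [leRHS]big_seq.
  apply: ler_sum => p ps; move: ss => /andP[/allP/(_ _ ps)/and3P[ap /ltW pp pc] _].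
  by rewrite ger0_norm// V_ge0.
have [f2 [if2 f2E]] : exists f, mu.-integrable setT (EFin \o f) /\
    forall x y, a < x -> x <= y -> y < c ->
    (((V y - w y) - (V x - w x))%:E = \int[mu]_(t in `]x, y]) (f t)%:E)%E.
  apply: (monotone_AC_density (F := fun x => V x - w x) ac).
    move=> x y ax xy yc; have := wV x y ax xy yc; rewrite ler_norml => /andP[_].
    lra.
  move=> e e0; have e20 : 0 < e / 2 by rewrite divr_gt0.
  have [d d0 H] := VAC _ e20; exists d => // s ss sd.
  apply: (@le_trans _ _ (2 * \sum_(p <- s) (V p.2 - V p.1))); last first.
    by have := H s ss sd; lra.
  rewrite mulr_sumr big_seq [leRHS]big_seq.
  apply: ler_sum => p ps; move: ss => /andP[/allP/(_ _ ps)/and3P[ap /ltW pp pc] _].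
  have := wV _ _ ap pp pc; rewrite !ler_norml => /andP[? ?].
  by apply/andP; split; lra.
exists (fun t => f1 t - f2 t); split.
  have := integrableB measurableT if1 if2.
  by apply: eq_integrable => // x _ /=; rewrite EFinB.
move=> x y ax xy yc.
have mI : measurable (`]x, y]%classic : set R) by exact: measurable_itv.
under eq_integral do rewrite EFinB.
rewrite integralB//; [|exact: (integrableS measurableT)|exact: (integrableS measurableT)].
rewrite -f1E// -f2E// -EFinB; congr EFin; ring.
Qed.

Lemma locally_AC_continuous w : locally_absolutely_continuous w -> continuous w.
Proof.
move=> acw x; have x11 : x - 1 <= x + 1 by lra.
have /AC_seqP acx := acw _ _ x11.
apply/cvgrPdist_le => e e0; have [d d0 H] := acx e e0.
near=> y.
have : `|x - y| < Num.min d 1.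
  by near: y; exists (Num.min d 1) => //=; rewrite lt_min d0 ltr01.
rewrite lt_min => /andP[xyd xy1].
have [xy|yx|->] := ltgtP x y; last by rewrite subrr normr0 ltW.
  have := H [:: (x, y)]; rewrite !big_seq1 /= distrC; apply.
    move: xy1; rewrite distrC gtr0_norm ?subr_gt0// => xy1.
    by rewrite /subintervals /= xy !andbT; apply/andP; split; lra.
  by move: xyd; rewrite distrC gtr0_norm ?subr_gt0.
have := H [:: (y, x)]; rewrite !big_seq1 /=; apply.
  move: xy1; rewrite gtr0_norm ?subr_gt0// => xy1.
  by rewrite /subintervals /= yx !andbT; apply/andP; split; lra.
by move: xyd; rewrite gtr0_norm ?subr_gt0.
Unshelve. all: by end_near. Qed.

Lemma derive1_near_addr (w F : R -> R) (k x : R) :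
  (\forall z \near x, w z = F z + k) -> derivable F x 1 ->
  derivable w x 1 /\ derive1 w x = derive1 F x.
Proof.
move=> wF dF; have dk : derivable (cst k : R -> R) x 1 by exact: derivable_cst.
have {}wF : \forall z \near x, w z = (F + cst k) z by apply: filterS wF => z ->.
split.
  have Fw : {near x, (F + cst k) =1 w} by apply: filterS wF => z /esym.
  exact: near_eq_derivable Fw (derivableD dF dk).
by rewrite !derive1E (near_eq_derive _ wF) (deriveD dF dk) derive_cst addr0.
Qed.

Lemma AC_ae_derivable a c w : a < c -> absolutely_continuous_on a c w ->
  exists f, [/\ mu.-integrable setT (EFin \o f),
  (forall x y, a < x -> x <= y -> y < c ->
    ((w y - w x)%:E = \int[mu]_(t in `]x, y]) (f t)%:E)%E) &
  {ae mu, forall x, a < x < c -> derivable w x 1 /\ derive1 w x = f x}].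
Proof.
move=> ac acw; have [f [intf fE]] := AC_density ac acw; exists f; split=> //.
have intfS (A : set R) : measurable A -> mu.-integrable A (EFin \o f).
  by move=> mA; exact: (integrableS measurableT).
have locf : locally_integrable setT f.
  by have := integrable_locally measurableT intf; rewrite patch_setT.
have intfNy y : mu.-integrable `]-oo, y] (EFin \o f).
  by apply: intfS; exact: measurable_itv.
pose F x := \int[mu]_(t in `]-oo, x]) f t.
have : {ae mu, forall x, derivable F x 1 /\ derive1 F x = f x}.
  exact: FTC1Ny intfNy locf.
apply: filterS; first exact: (ae_filter_ringOfSetsType mu).
move=> x /= [dF F'x] /andP[ax xc].
have near_wF : \forall z \near x, w z = F z + (w x - F x).
  near=> z.
  have /andP[az zc] : a < z < c.
    by apply/andP; split; near: z; [exact: lt_nbhsr|exact: lt_nbhsl].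
  have wB p q : a < p -> p <= q -> q < c -> w q - w p = F q - F p.
    move=> ap pq qc; rewrite /F Rintegral_itvB ?bnd_simp//.
    by rewrite /Rintegral -(fE p q).
  have [xz|/ltW zx] := leP x z.
    by have := wB _ _ ax xz zc; lra.
  by have := wB _ _ az zx xc; lra.
by rewrite -F'x; exact: derive1_near_addr near_wF dF.
Unshelve. all: by end_near. Qed.

(** A measurable function, defined everywhere, that agrees with [|w'|] wherever
    [w] is differentiable: [derive1 w] itself takes default values elsewhere. The
    outer absolute value only makes nonnegativity immediate. *)
Definition upper_slope w x : \bar R :=
  `|limn_esup (fun k => (`|(w (x + harmonic k) - w x) / harmonic k|)%:E)|%E.

Lemma measurable_upper_slope w : continuous w ->
  measurable_fun setT (upper_slope w).
Proof.
move=> /continuous_measurable_fun mw; apply: measurableT_comp => //.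
apply: measurable_fun_limn_esup => k; apply/measurable_EFinP.
apply: measurableT_comp => //; apply: measurable_funM => //.
apply: measurable_funB => //; apply: measurableT_comp => //.
exact: measurable_funD.
Qed.

Lemma upper_slope_derivable w x : derivable w x 1 ->
  upper_slope w x = (`|derive1 w x|)%:E.
Proof.
move=> dw.
have : h^-1 *: ((w \o shift x) (h *: 1) - w x) @[h --> 0^'+] --> derive1 w x.
  by apply: cvg_dnbhs_at_right; rewrite derive1E.
move=> /cvg_at_rightP/(_ harmonic) H.
have {}H := H (conj (fun n => harmonic_gt0 n) cvg_harmonic).
rewrite /upper_slope.
set u := fun k => _.
have : u k @[k --> \oo] --> (`|derive1 w x|)%:E.
  apply/cvg_EFin; first by near=> k.
  apply: cvg_norm; apply: cvg_trans H; apply: near_eq_cvg; near=> k => /=.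
  by rewrite [LHS]mulrC [_%:A]mulr1 (addrC x).
by move=> /cvg_limn_einf_sup[_ ->] /=; rewrite normr_id.
Unshelve. all: by end_near. Qed.

(** The integral of a nonnegative function is a supremum over the simple
    functions below it, which compares it with [h2] even when [h2] is not
    measurable. *)
Lemma ge0_le_lower_integral (h1 h2 : R -> \bar R) :
  measurable_fun setT h1 -> (forall x, 0 <= h1 x)%E -> (forall x, 0 <= h2 x)%E ->
  {ae mu, forall x, (h1 x <= h2 x)%E} ->
  (\int[mu]_x h1 x <= \int[mu]_x h2 x)%E.
Proof.
move=> mh1 h10 h20 [N [mN N0 hN]].
rewrite (@ge0_negligible_integral _ _ _ mu setT N)// integral_mkcond.
rewrite ge0_integralE; last first.
  by move=> x _; rewrite patchE; case: ifP.
rewrite ge0_integralE//; apply: ereal_sup_le => _ [h hh <-]; exists h => // x.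
apply: le_trans (hh x) _; rewrite !patchE !in_setT.
case: ifPn => [|_]; last exact: h20.
by rewrite inE /= => -[_ Nx]; apply: contrapT => /hN.
Qed.

Section locally_AC.
Variable w : R -> R.
Hypothesis acw : locally_absolutely_continuous w.

Let N_pos n : - n.+1%:R < n.+1%:R :> R.
Proof. by have : 0 < n.+1%:R :> R; [rewrite ltr0n|lra]. Qed.

Lemma locally_AC_ae_derivable : {ae mu, forall x, derivable w x 1}.
Proof.
have H n : {ae mu, forall x, - n.+1%:R < x < n.+1%:R -> derivable w x 1}.
  have [f [_ _]] := AC_ae_derivable (N_pos n) (acw (ltW (N_pos n))).
  by apply: filterS; [exact: (ae_filter_ringOfSetsType mu)|move=> x H /H[]].
apply: filterS (ae_foralln H).
move=> x /(_ (Num.bound `|x|)); apply; rewrite -ltr_norml.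
by apply: lt_trans (archi_boundP _) _; rewrite ?normr_ge0 ?ltr_nat.
Qed.

Lemma increment_le_upper_slope x y : x <= y ->
  ((`|w y - w x|)%:E <= \int[mu]_(t in `]x, y]) upper_slope w t)%E.
Proof.
move=> xy; pose n := Num.bound (`|x| + `|y|).
have xyn : `|x| + `|y| < n.+1%:R.
  by apply: lt_trans (archi_boundP _) _; rewrite ?addr_ge0// ltr_nat.
have /andP[nx _] : - n.+1%:R < x < n.+1%:R.
  by rewrite -ltr_norml (le_lt_trans _ xyn)// lerDl.
have /andP[_ yn] : - n.+1%:R < y < n.+1%:R.
  by rewrite -ltr_norml (le_lt_trans _ xyn)// lerDr.
have [f [intf fE fD]] := AC_ae_derivable (N_pos n) (acw (ltW (N_pos n))).
have mI : measurable (`]x, y]%classic : set R) by exact: measurable_itv.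
have /measurable_int mf : mu.-integrable `]x, y] (EFin \o f).
  exact: (integrableS measurableT).
have -> : (`|w y - w x|%:E = `|\int[mu]_(t in `]x, y]) (f t)%:E|)%E.
  by rewrite -(fE x y).
apply: (le_trans (le_abse_integral mu mI mf)).
rewrite le_eqVlt; apply/orP; left; apply/eqP; apply: ae_eq_integral => //.
- exact: measurableT_comp.
- apply: measurable_funTS; apply: measurable_upper_slope.
  exact: locally_AC_continuous.
apply: filterS fD; first exact: (ae_filter_ringOfSetsType mu).
move=> t H /=; rewrite in_itv/= => /andP[xt ty].
have [|dw wE] := H; first by rewrite (lt_trans nx) ?(le_lt_trans ty).
by rewrite upper_slope_derivable// wE.
Qed.

Lemma integral_upper_slope_le :
  (\int[mu]_s (`|s|%:E * upper_slope w s) <=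
   \int[mu]_s (`|s * derive1 w s|)%:E)%E.
Proof.
apply: ge0_le_lower_integral.
- apply: emeasurable_funM.
    by apply/measurable_EFinP; exact: normr_measurable.
  by apply: measurable_upper_slope; exact: locally_AC_continuous.
- by move=> s; rewrite mule_ge0 ?lee_fin ?abse_ge0.
- by move=> s; rewrite lee_fin.
apply: filterS locally_AC_ae_derivable; first exact: (ae_filter_ringOfSetsType mu).
by move=> s ds; rewrite upper_slope_derivable// normrM EFinM.
Qed.

End locally_AC.
End AC_derivative.

(** * Dilations *)

Section dilation.
Variable R : realType.
Notation mu := (@lebesgue_measure R).
Implicit Types (m : R) (h w : R -> R).

Lemma continuous_dilation m h : continuous h -> continuous (fun x => h (m * x)).
Proof.
move=> ch x; apply: (@continuous_comp _ _ _ (fun y => m * y) h); last exact: ch.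
exact: mulrl_continuous.
Qed.

Lemma ge0_integral_dilation m h : 0 < m -> continuous h -> (forall x, 0 <= h x) ->
  (\int[mu]_x (h x)%:E = m%:E * \int[mu]_x (h (m * x))%:E)%E.
Proof.
move=> m0 ch h0; pose F (x : R) : R := m * x.
have dF (x : R) : is_derive x 1 F m.
  have : is_derive x (1 : R) (m \*: (@id R^o)) (m *: 1) by exact: is_deriveZ.
  by rewrite [_%:A]mulr1.
have F'E : derive1 F = cst m.
  by apply/funext => x; rewrite derive1E (@derive_val _ _ _ _ _ _ _ (dF x)).
rewrite (@increasing_ge0_integration_by_substitutionT R F h)//.
- rewrite F'E -ge0_integralZl//; first last.
  + by rewrite lee_fin ltW.
  + by move=> x _; rewrite lee_fin.
  + apply/measurable_EFinP; apply: continuous_measurable_fun.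
    exact: continuous_dilation.
  by apply: eq_integral => x _; rewrite /= mulrC EFinM.
- by move=> x y xy; rewrite /F ltr_pM2l.
- by rewrite F'E => x; exact: cvg_cst.
- by rewrite F'E; exact: is_cvg_cst.
- by rewrite F'E; exact: is_cvg_cst.
- exact: gt0_cvgMrNy.
- exact: gt0_cvgMry.
Qed.

Lemma integrable_dilation m h : 0 < m -> continuous h ->
  mu.-integrable setT (EFin \o h) ->
  mu.-integrable setT (EFin \o (fun x => h (m * x))).
Proof.
move=> m0 ch /integrableP[_ hoo]; apply/integrableP; split.
  apply/measurable_EFinP; apply: continuous_measurable_fun.
  exact: continuous_dilation.
have ca : continuous (fun x => `|h x|).
  by move=> x; apply: (@continuous_comp _ _ _ h Num.norm);
    [exact: ch|exact: norm_continuous].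
have := ge0_integral_dilation m0 ca (fun=> normr_ge0 _).
set I := (X in (_ = _ * X)%E) => IE.
rewrite ltey; apply/eqP => Ioo.
by move: hoo; rewrite [X in (X < _)%E]IE [I]Ioo gt0_muley ?lte_fin.
Qed.

(** Reduced to [ge0_integral_dilation] by [h = (h + |h|) - |h|], whose two terms
    are nonnegative and continuous. *)
Lemma Rintegral_dilation m h : 0 < m -> continuous h ->
  mu.-integrable setT (EFin \o h) ->
  \int[mu]_x h x = m * \int[mu]_x h (m * x).
Proof.
move=> m0 ch ih.
have ca : continuous (fun x => `|h x|).
  by move=> x; apply: (@continuous_comp _ _ _ h Num.norm);
    [exact: ch|exact: norm_continuous].
have ia : mu.-integrable setT (EFin \o (fun x => `|h x|)).
  by have := integrable_abse ih; apply: eq_integrable.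
have cp : continuous (fun x => h x + `|h x|).
  by move=> x; apply: cvgD; [exact: ch|exact: ca].
have ip : mu.-integrable setT (EFin \o (fun x => h x + `|h x|)).
  by have := integrableD measurableT ih ia; apply: eq_integrable.
have p0 x : 0 <= h x + `|h x|.
  by rewrite -lerBlDl sub0r -normrN ler_norm.
have scaleE (g : R -> R) : continuous g -> (forall x, 0 <= g x) ->
    mu.-integrable setT (EFin \o g) -> \int[mu]_x g x = m * \int[mu]_x g (m * x).
  move=> cg g0 ig; rewrite /Rintegral (ge0_integral_dilation m0 cg g0) fineM//.
  by apply: integrable_fin_num => //; exact: integrable_dilation.
have -> : \int[mu]_x h x = \int[mu]_x (h x + `|h x|) - \int[mu]_x `|h x|.
  rewrite -RintegralB//; apply: eq_Rintegral => x _; by rewrite addrK.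
rewrite (scaleE _ cp p0 ip) (scaleE _ ca (fun=> normr_ge0 _) ia) -mulrBr.
rewrite -RintegralB//; [|exact: (integrable_dilation m0 cp ip)|
                         exact: (integrable_dilation m0 ca ia)].
by congr (_ * _); apply: eq_Rintegral => x _; rewrite addrK.
Qed.

Definition separates (x y s : R) : bool := (x < s <= y) || (y < s <= x).

Lemma separates_dilation m x s : 0 < m -> separates x (m * x) s ->
  `[Num.min s (s / m), Num.max s (s / m)]%classic x.
Proof.
move=> m0; pose r := s / m; have sE : s = m * r by rewrite /r mulrC divfK ?gt_eqF.
have mono (p q : R) : (m * p <= m * q) = (p <= q) by rewrite ler_pM2l.
rewrite /separates -/r => /orP[]/andP[h1 h2].
  have rx : r <= x by rewrite -mono -sE.
  by rewrite /= in_itv/= ge_min rx orbT le_max (ltW h1).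
have xr : x <= r by rewrite -mono -sE ltW.
by rewrite /= in_itv/= ge_min h2 le_max xr orbT.
Qed.

(** The increment [w (m * x) - w x] is at most the integral of [g] over the [s]
    that separate [x] from [m * x]. For fixed [s], those [x] lie between [s] and
    [s / m], an interval of length [|s| * |1 - m| / m]; conclude by Tonelli. *)
Lemma integral_increment_dilation_le m w (g : R -> \bar R) : 0 < m ->
  continuous w -> measurable_fun setT g -> (forall s, 0 <= g s)%E ->
  (forall x y, x <= y ->
    ((`|w y - w x|)%:E <= \int[mu]_(t in `]x, y]) g t)%E) ->
  (\int[mu]_x (`|w (m * x) - w x|)%:E <=
   (`|1 - m| / m)%:E * \int[mu]_s (`|s|%:E * g s))%E.
Proof.
move=> m0 cw mg g0 wg.
pose phi (z : R * R) : \bar R := if separates z.1 (m * z.1) z.2 then g z.2 else 0%E.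
have phi0 z : (0 <= phi z)%E by rewrite /phi; case: ifP.
have mm : measurable_fun setT (fun z : R * R => m * z.1) by exact: measurable_funM.
have mphi : measurable_fun setT phi.
  apply: measurable_fun_ifT => //; last exact: measurableT_comp.
  apply: measurable_or; apply: measurable_and.
  - exact: measurable_fun_ltr.
  - exact: measurable_fun_ler.
  - exact: measurable_fun_ltr.
  - exact: measurable_fun_ler.
apply: (@le_trans _ _ (\int[mu]_x \int[mu]_s phi (x, s))%E).
  apply: ge0_le_integral => //.
  - apply/measurable_EFinP; apply: measurableT_comp => //.
    apply: measurable_funB; last exact: continuous_measurable_fun.
    by apply: continuous_measurable_fun; exact: continuous_dilation.
  - exact: (@measurable_fun_fubini_tonelli_F _ _ _ _ _ mu phi).
  move=> x _.
  have E p q : p <= q -> (forall s, (p < s <= q) = separates x (m * x) s) ->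
      (`|w q - w p|%:E <= \int[mu]_s phi (x, s))%E.
    move=> pq sE; apply: (le_trans (wg _ _ pq)); rewrite integral_mkcond.
    rewrite le_eqVlt; apply/orP; left; apply/eqP; apply: eq_integral => s _.
    by rewrite patchE /phi /= -sE mem_setE in_itv/=.
  have no_sep (p q s : R) : p <= q -> (q < s <= p) = false.
    by move=> pq; apply/negP => /andP[? ?]; lra.
  have [xm|/ltW mx] := leP x (m * x).
    by apply: E => // s; rewrite /separates (no_sep _ _ _ xm) orbF.
  by rewrite distrC; apply: E => // s; rewrite /separates (no_sep _ _ _ mx).
rewrite (@fubini_tonelli _ _ _ _ _ mu mu phi)//.
rewrite -ge0_integralZl//; first last.
- by rewrite lee_fin divr_ge0 ?(ltW m0).
- by move=> s _; rewrite mule_ge0.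
- by apply: emeasurable_funM => //; apply/measurable_EFinP; exact: normr_measurable.
apply: ge0_le_integral => //.
- by move=> s _; apply: integral_ge0 => x _; exact: phi0.
- exact: (@measurable_fun_fubini_tonelli_G _ _ _ _ _ mu phi).
- apply: emeasurable_funM => //; apply: emeasurable_funM => //.
  by apply/measurable_EFinP; exact: normr_measurable.
move=> s _; pose I := `[Num.min s (s / m), Num.max s (s / m)]%classic.
have mI : measurable (I : set R) by exact: measurable_itv.
apply: (@le_trans _ _ (\int[mu]_(x in I) (cst (g s) x))%E).
  rewrite [leRHS]integral_mkcond; apply: ge0_le_integral => //.
  - exact: (measurable_fun_pair1 s mphi).
  - by apply/(measurable_restrictT _ _).1.
  move=> x _; rewrite /phi /= patchE; case: ifPn => [/(separates_dilation m0) xI|_].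
    by rewrite ifT// inE.
  by case: ifP => // _; exact: g0.
rewrite integral_cst// [X in (_ * X)%E](_ : _ = (`|1 - m| / m * `|s|)%:E).
  by rewrite muleC EFinM muleA.
rewrite /I /= lebesgue_measure_itv/= lte_fin.
have -> : `|1 - m| / m * `|s| = `|s - s / m|.
  have -> : s - s / m = - ((1 - m) / m * s) by field; rewrite gt_eqF.
  by rewrite normrN !normrM normfV (gtr0_norm m0).
have [sm|ms|ssm] := ltgtP s (s / m).
- by rewrite sm distrC gtr0_norm ?subr_gt0// EFinB.
- by rewrite ms gtr0_norm ?subr_gt0// EFinB.
- by rewrite -ssm ltxx subrr normr0.
Qed.

Lemma continuous_gauss (v a y : R) : continuous (fun x : R => gauss v (a * x) y).
Proof.
move=> x; rewrite /gauss; apply: cvgM; first exact: cvg_cst.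
apply: (@continuous_comp _ _ _ (fun x => - ((y - a * x) ^+ 2 / (2 * v))) expR);
  last exact: continuous_expR.
apply: cvgN; apply: cvgM; last exact: cvg_cst.
apply: (@continuous_comp _ _ _ (fun x => y - a * x) (fun z => z ^+ 2));
  last exact: exprn_continuous.
apply: cvgB; first exact: cvg_cst.
exact: mulrl_continuous.
Qed.

(** With [m = a2 / a1], the substitution [x := m * x] gives
    [gauss_op a1 v w = gauss_op a2 v (m w(m .))], and [gauss_op a2 v] is a
    contraction of L^1, so that only the norm of [w - m w(m .)] matters. *)
Lemma gauss_op_dilation_le a1 a2 v w (g : R -> \bar R) : 0 < v -> 0 < a1 -> 0 < a2 ->
  continuous w -> mu.-integrable setT (EFin \o w) ->
  measurable_fun setT g -> (forall s, 0 <= g s)%E ->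
  (forall x y, x <= y ->
    ((`|w y - w x|)%:E <= \int[mu]_(t in `]x, y]) g t)%E) ->
  (\int[mu]_y (`|gauss_op a1 v w y - gauss_op a2 v w y|)%:E <=
   (`|1 - a2 / a1| / (a2 / a1))%:E *
   (\int[mu]_x (`|w x|)%:E + \int[mu]_s (`|s|%:E * g s)))%E.
Proof.
move=> v0 a10 a20 cw iw mg g0 wg; set m := a2 / a1.
have m0 : 0 < m by rewrite divr_gt0.
pose wm x := w (m * x).
have cwm : continuous wm by exact: continuous_dilation.
have iwm : mu.-integrable setT (EFin \o wm) by exact: integrable_dilation.
pose d x := m * wm x - w x.
have imwm : mu.-integrable setT (EFin \o (fun x => m * wm x)).
  by have := integrableZl measurableT m iwm; apply: eq_integrable.
have id : mu.-integrable setT (EFin \o d).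
  by have := integrableB measurableT imwm iw; apply: eq_integrable.
have mwm : measurable_fun setT wm by exact: continuous_measurable_fun.
have mw : measurable_fun setT w by exact: continuous_measurable_fun.
have ig u a y : mu.-integrable setT (EFin \o u) ->
    mu.-integrable setT (EFin \o (fun x => gauss v (a * x) y * u x)).
  by move=> iu; apply: integrable_gaussM => //; exact: measurable_funM.
have diffE y : gauss_op a1 v w y - gauss_op a2 v w y = gauss_op a2 v d y.
  rewrite /gauss_op (Rintegral_dilation m0) ?ig//; last first.
    by move=> x; apply: cvgM; [exact: continuous_gauss|exact: cw].
  rewrite -RintegralZl//; last first.
    have := ig wm (a1 * m) y iwm; apply: eq_integrable => // x _ /=.
    by rewrite -(mulrA a1 m x).
  rewrite -RintegralB ?ig//; last first.
    have := ig _ (a1 * m) y imwm; apply: eq_integrable => // x _ /=.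
    by rewrite /wm mulrCA -(mulrA a1 m x).
  apply: eq_Rintegral => x _; rewrite /d /wm.
  have -> : a1 * (m * x) = a2 * x by rewrite /m; field; rewrite gt_eqF.
  ring.
under eq_integral do rewrite diffE.
apply: (le_trans (integral_gauss_op_le a2 v0 id)).
have wnorm : (\int[mu]_x (`|wm x|)%:E = (m^-1)%:E * \int[mu]_x (`|w x|)%:E)%E.
  have ca : continuous (fun x => `|w x|).
    by move=> x; apply: (@continuous_comp _ _ _ w Num.norm);
      [exact: cw|exact: norm_continuous].
  rewrite (ge0_integral_dilation m0 ca)// muleA -EFinM mulVf ?mul1e//.
  by rewrite gt_eqF.
apply: (@le_trans _ _ (`|1 - m|%:E * \int[mu]_x (`|wm x|)%:E +
                       \int[mu]_x (`|w (m * x) - w x|)%:E)%E).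
  have mabs (u : R -> R) : measurable_fun setT u ->
      measurable_fun setT (fun x => (`|u x|)%:E).
    by move=> ?; apply/measurable_EFinP; exact: measurableT_comp.
  rewrite -ge0_integralZl//; [|exact: mabs].
  rewrite -ge0_integralD//; first last.
  - by apply: mabs; exact: measurable_funB.
  - by apply: emeasurable_funM => //; exact: mabs.
  apply: ge0_le_integral => //.
  - by apply: mabs; apply: measurable_funB => //; exact: measurable_funM.
  - apply: emeasurable_funD; first by apply: emeasurable_funM => //; exact: mabs.
    by apply: mabs; exact: measurable_funB.
  move=> x _; rewrite -EFinM -EFinD lee_fin -normrM.
  have -> : d x = - ((1 - m) * wm x) + (wm x - w x) by rewrite /d; ring.
  by rewrite (le_trans (ler_normD _ _))// normrN.
have W0 : (0 <= \int[mu]_x (`|w x|)%:E)%E by exact: integral_ge0.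
have G0 : (0 <= \int[mu]_s (`|s|%:E * g s))%E.
  by apply: integral_ge0 => s _; rewrite mule_ge0.
rewrite wnorm muleA -EFinM (ge0_muleDr _ W0 G0).
by apply: leeD => //; exact: integral_increment_dilation_le.
Qed.

End dilation.

(** * Convergence of the propagators *)

Section error_bounds.
Variable R : realType.
Notation mu := (@lebesgue_measure R).
Implicit Types (b sigma t T a v : R) (u w : R -> R).

Lemma em_error_0 b sigma u n : em_error b sigma u 0 n = 0%E.
Proof.
rewrite /em_error N1E mul0r.
have -> : iter n (em_propagator b sigma 0) u = u.
  by elim: n => //= n ->; rewrite /em_propagator eqxx.
rewrite /ou_propagator eqxx.
by under eq_integral do rewrite /= subrr normr0; rewrite integral0.
Qed.

Lemma em_error_gauss_op b sigma t u n : sigma != 0 -> 0 < t -> (0 < n)%N ->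
  mu.-integrable setT (EFin \o u) ->
  em_error b sigma u t n =
  (\int[mu]_y (`|gauss_op (expR (b * t)) (ou_var b sigma t) u y -
                 gauss_op (em_factor b t n) (em_var b sigma t n) u y|)%:E)%E.
Proof.
move=> s0 t0 n0 iu; rewrite /em_error N1E iter_em_propagatorE//.
by rewrite ou_propagatorE// gt_eqF.
Qed.

Lemma integral_gaussB_le2 v1 m1 v2 m2 : 0 < v1 -> 0 < v2 ->
  (\int[mu]_y (`|gauss v1 m1 y - gauss v2 m2 y|)%:E <= 2%:E)%E.
Proof.
move=> v10 v20.
have mG v m : measurable_fun setT (fun y : R => (`|gauss v m y|)%:E).
  apply/measurable_EFinP; apply: measurableT_comp => //.
  exact: measurable_gauss.
have -> : (2%:E = \int[mu]_y (`|gauss v1 m1 y|)%:E + \int[mu]_y (`|gauss v2 m2 y|)%:E)%E.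
  by rewrite !integral_norm_gauss// -EFinD.
rewrite -ge0_integralD//; [|exact: mG|exact: mG].
apply: ge0_le_integral => //.
- apply/measurable_EFinP; apply: measurableT_comp => //.
  by apply: measurable_funB; exact: measurable_gauss.
- by apply: emeasurable_funD; exact: mG.
by move=> y _; rewrite -EFinD lee_fin ler_normB.
Qed.

Lemma integral_gaussB_le_rate v1 a1 v2 a2 (r : R) x : 0 < v1 -> 0 < v2 ->
  `|v1 - v2| / v1 <= r -> `|a1 - a2| / Num.sqrt v1 <= r ->
  (\int[mu]_y (`|gauss v1 (a1 * x) y - gauss v2 (a2 * x) y|)%:E <=
   (3 * r * (1 + `|x|))%:E)%E.
Proof.
move=> v10 v20 vr ar; apply: (le_trans (integral_gaussB_le _ _ v10 v20)).
rewrite lee_fin -mulrA ler_wpM2l// mulrDr mulr1 lerD// -mulrBl normrM mulrAC.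
by rewrite ler_wpM2r.
Qed.

Lemma eq_gauss_op a v u w : measurable_fun setT u -> measurable_fun setT w ->
  {ae mu, forall x, w x = u x} -> gauss_op a v u = gauss_op a v w.
Proof.
move=> mu_u mw wu; apply/funext => y; congr fine; apply: ae_eq_integral => //.
- apply/measurable_EFinP/measurable_funM => //.
  by apply: measurable_gauss => //; exact: measurable_funM.
- apply/measurable_EFinP/measurable_funM => //.
  by apply: measurable_gauss => //; exact: measurable_funM.
apply: filterS wu; first exact: (ae_filter_ringOfSetsType mu).
by move=> x /= ->.
Qed.

Lemma mul_cst_integral_norm (c : R) u : 0 <= c -> measurable_fun setT u ->
  (\int[mu]_x (c * `|u x|)%:E = c%:E * \int[mu]_x (`|u x|)%:E)%E.
Proof.
move=> c0 mu_u; rewrite -ge0_integralZl//.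
by apply/measurable_EFinP; exact: measurableT_comp.
Qed.

Section rates.
Variables (b sigma T : R) (u : R -> R).
Hypotheses (s0 : sigma != 0) (T0 : 0 < T).
Hypothesis iu : mu.-integrable setT (EFin \o u).

Let mu_u : measurable_fun setT u.
Proof. by move/measurable_int : iu => /measurable_EFinP. Qed.

Let uoo : (\int[mu]_x (`|u x|)%:E < +oo)%E.
Proof. exact: integrable_norm_lty. Qed.

(* The bound [integral_gaussB_le_rate] truncated by [integral_gaussB_le2], so
   as to be integrable against any integrable function. *)
Let truncated (r x : R) := Num.min 2 (3 * r * (1 + `|x|)).

Let measurable_truncated r : measurable_fun setT (truncated r).
Proof.
apply: measurable_minr => //; apply: measurable_funM => //.
by apply: measurable_funD => //; exact: normr_measurable.
Qed.

Let mabs : measurable_fun setT (fun x => `|u x|).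
Proof. exact: measurableT_comp. Qed.

Let measurable_truncatedM r :
  measurable_fun setT (fun x => (truncated r x * `|u x|)%:E).
Proof.
by apply/measurable_EFinP/measurable_funM => //; exact: measurable_truncated.
Qed.

Let truncated_ge0 r x : 0 <= r -> 0 <= truncated r x.
Proof.
move=> r0; rewrite le_min ler0n/=; apply: mulr_ge0; first exact: mulr_ge0.
exact: addr_ge0.
Qed.

Let truncated_dominated r x : 0 <= r -> truncated r x * `|u x| <= 2 * `|u x|.
Proof. by move=> r0; rewrite ler_wpM2r// ge_min lexx. Qed.

Let truncated_integral_lty r : 0 <= r ->
  (\int[mu]_x (truncated r x * `|u x|)%:E < +oo)%E.
Proof.
move=> r0; apply: (@le_lt_trans _ _ (\int[mu]_x (2 * `|u x|)%:E)%E); last first.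
  by rewrite mul_cst_integral_norm// lte_mul_pinfty.
apply: ge0_le_integral => //.
- by move=> x _; rewrite lee_fin mulr_ge0// truncated_ge0.
- exact: measurable_truncatedM.
- by apply/measurable_EFinP/measurable_funM.
by move=> x _; rewrite lee_fin truncated_dominated.
Qed.

Let cvg_truncated_integral (C : R) : 0 <= C ->
  (\int[mu]_x (truncated (C / n%:R) x * `|u x|)%:E @[n --> \oo] --> 0)%E.
Proof.
move=> C0.
have r0 n : 0 <= C / n%:R by rewrite divr_ge0.
have := @dominated_convergence _ _ _ mu setT measurableT
  (fun n x => (truncated (C / n%:R) x * `|u x|)%:E) (cst 0%E)
  (fun x => (2 * `|u x|)%:E).
rewrite integral0; case=> //.
- by move=> n; exact: measurable_truncatedM.
- apply: aeW => x _; apply/cvg_EFin; first by near=> n.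
  rewrite /comp /=.
  have H : (3 * (1 + `|x|) * `|u x| * C) / n%:R @[n --> \oo] --> (0 : R).
    rewrite -[X in _ --> X](mulr0 (3 * (1 + `|x|) * `|u x| * C)).
    apply: cvgM; first exact: cvg_cst.
    apply/gtr0_cvgV0; first by near=> n; rewrite ltr0n; near: n; exists 1%N.
    exact: cvgr_idn.
  apply: squeeze_cvgr (cvg_cst 0) H; near=> n; apply/andP; split.
    by rewrite mulr_ge0// truncated_ge0.
  have -> : 3 * (1 + `|x|) * `|u x| * C / n%:R =
      3 * (C / n%:R) * (1 + `|x|) * `|u x| by ring.
  by rewrite ler_wpM2r// ge_min lexx orbT.
- apply/integrableP; split.
    by apply/measurable_EFinP/measurable_funM.
  under eq_integral do rewrite /= ger0_norm ?mulr_ge0//.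
  by rewrite mul_cst_integral_norm// lte_mul_pinfty.
- apply: aeW => x n _; rewrite /= lee_fin ger0_norm ?mulr_ge0 ?truncated_ge0//.
  exact: truncated_dominated.
Unshelve. all: by end_near. Qed.

(** The truncated bound for [t = T] dominates those for all [t <= T]. *)
Lemma cvg_sup_em_error :
  ereal_sup [set em_error b sigma u t n | t in `[0, T]] @[n --> \oo] --> 0%E.
Proof.
have [C [N [C0 N0 rates]]] := em_rates b s0 T0.
have CT0 : 0 <= C * T by rewrite mulr_ge0 ?ltW.
apply: squeeze_cvge (cvg_cst 0%E) (cvg_truncated_integral CT0).
near=> n; have Nn : (N <= n)%N by near: n; exact: nbhs_infty_ge.
have n0 : (0 < n)%N by exact: leq_trans Nn.
have CTn0 : 0 <= C * T / n%:R by rewrite divr_ge0.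
apply/andP; split.
  apply: ereal_sup_ubound; exists 0; last exact: em_error_0.
  by rewrite /= in_itv/= lexx ltW.
apply: ge_ereal_sup => _ [t /= + <-]; rewrite in_itv/= => /andP[].
rewrite le_eqVlt => /predU1P[<- _|t0 tT].
  rewrite em_error_0; apply: integral_ge0 => x _.
  by rewrite lee_fin mulr_ge0// truncated_ge0.
have tT' : 0 < t <= T by rewrite t0.
have [v0 vr ar _ _] := rates t n tT' Nn.
rewrite em_error_gauss_op//; apply: gauss_opB_le => //.
- exact: em_var_gt0.
- move=> x; rewrite EFin_min le_min; apply/andP; split.
    by apply: integral_gaussB_le2 => //; exact: em_var_gt0.
  have CtT : C * t / n%:R <= C * T / n%:R.
    by rewrite ler_wpM2r ?invr_ge0// ler_wpM2l// ltW.
  apply: integral_gaussB_le_rate => //; first exact: em_var_gt0.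
    exact: le_trans CtT.
  exact: le_trans CtT.
- exact: truncated_integral_lty.
Unshelve. all: by end_near. Qed.

Lemma em_error_rate_moment : (\int[mu]_x (`|x * u x|)%:E < +oo)%E ->
  exists (C : R) (N : nat), [/\ 0 < C, (0 < N)%N &
  forall t : R, 0 <= t <= T -> forall n : nat, (N <= n)%N ->
  (em_error b sigma u t n <= (C * t / n%:R)%:E)%E].
Proof.
move=> xuoo; have [C [N [C0 N0 rates]]] := em_rates b s0 T0.
pose M := (\int[mu]_x (`|u x|)%:E + \int[mu]_x (`|x * u x|)%:E)%E.
have M0 : (0 <= M)%E by rewrite adde_ge0 ?integral_ge0// => x _; rewrite lee_fin.
have Mfin : M \is a fin_num by rewrite ge0_fin_numE// lte_add_pinfty.
exists (3 * C * fine M + 1), N; split=> //.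
  by rewrite ltr_wpDl//; nonneg; exact: fine_ge0.
move=> t /andP[]; rewrite le_eqVlt => /predU1P[<- _ n _|t0 tT n Nn].
  by rewrite em_error_0 mulr0 mul0r.
have n0 : (0 < n)%N by exact: leq_trans Nn.
have tT' : 0 < t <= T by rewrite t0.
have [v0 vr ar _ _] := rates t n tT' Nn.
have r0 : 0 <= 3 * (C * t / n%:R).
  by rewrite mulr_ge0// divr_ge0// mulr_ge0 ?ltW.
have intE : (\int[mu]_x (3 * (C * t / n%:R) * (1 + `|x|) * `|u x|)%:E =
    (3 * (C * t / n%:R))%:E * M)%E.
  rewrite /M -ge0_integralD//; first last.
  - by apply/measurable_EFinP; apply: measurableT_comp => //; exact: measurable_funM.
  - by apply/measurable_EFinP; exact: measurableT_comp.
  rewrite -ge0_integralZl//; first last.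
  - by move=> x _; rewrite adde_ge0 ?lee_fin.
  - apply: emeasurable_funD; apply/measurable_EFinP.
      exact: measurableT_comp.
    by apply: measurableT_comp => //; exact: measurable_funM.
  apply: eq_integral => x _; rewrite -EFinD -EFinM; congr EFin.
  by rewrite normrM; ring.
rewrite em_error_gauss_op//.
apply: (@le_trans _ _ (\int[mu]_x (3 * (C * t / n%:R) * (1 + `|x|) * `|u x|)%:E)%E).
  apply: gauss_opB_le => //.
  - exact: em_var_gt0.
  - by apply: measurable_funM => //; apply: measurable_funD => //;
      exact: normr_measurable.
  - by move=> x; apply: integral_gaussB_le_rate => //; exact: em_var_gt0.
  - by rewrite intE -(fineK Mfin) -EFinM ltry.
rewrite intE -(fineK Mfin) -EFinM lee_fin.
have -> : 3 * (C * t / n%:R) * fine M = 3 * C * fine M * t / n%:R by ring.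
by rewrite ler_wpM2r ?invr_ge0// ler_wpM2r ?ltW// ltrDl.
Qed.

(** The intermediate kernel has the exact linear factor and the Euler variance,
    so that the total variation bound is used for the variances only. *)
Lemma em_error_rate_AC w : {ae mu, forall x, w x = u x} ->
  locally_absolutely_continuous w ->
  (\int[mu]_x (`|x * derive1 w x|)%:E < +oo)%E ->
  exists (C : R) (N : nat), [/\ 0 < C, (0 < N)%N &
  forall t : R, 0 <= t <= T -> forall n : nat, (N <= n)%N ->
  (em_error b sigma u t n <= (C * t / n%:R)%:E)%E].
Proof.
move=> wu acw xwoo; have [C [N [C0 N0 rates]]] := em_rates b s0 T0.
have cw := locally_AC_continuous acw.
have mw : measurable_fun setT w by exact: continuous_measurable_fun.
have nwE : (\int[mu]_x (`|w x|)%:E = \int[mu]_x (`|u x|)%:E)%E.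
  apply: ae_eq_integral => //.
  - by apply/measurable_EFinP; exact: measurableT_comp.
  - by apply/measurable_EFinP; exact: measurableT_comp.
  apply: filterS wu; first exact: (ae_filter_ringOfSetsType mu).
  by move=> x /= ->.
have iw : mu.-integrable setT (EFin \o w).
  apply/integrableP; split; first exact/measurable_EFinP.
  by rewrite /= nwE.
pose W := (\int[mu]_x (`|w x|)%:E)%E.
pose G := (\int[mu]_s (`|s|%:E * upper_slope w s))%E.
have W0 : (0 <= W)%E by exact: integral_ge0.
have G0 : (0 <= G)%E.
  by apply: integral_ge0 => s _; rewrite mule_ge0 ?lee_fin ?abse_ge0.
have Wfin : W \is a fin_num by rewrite ge0_fin_numE// /W nwE; exact: uoo.
have Gfin : G \is a fin_num.
  by rewrite ge0_fin_numE//; apply: le_lt_trans xwoo; exact: integral_upper_slope_le.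
pose K := 3 * fine W + 2 * (fine W + fine G).
have K0 : 0 <= K by rewrite /K; nonneg; exact: fine_ge0.
exists (C * K + 1), N; split=> //.
  by rewrite ltr_wpDl// mulr_ge0// ltW.
move=> t /andP[]; rewrite le_eqVlt => /predU1P[<- _ n _|t0 tT n Nn].
  by rewrite em_error_0 mulr0 mul0r.
have n0 : (0 < n)%N by exact: leq_trans Nn.
have tT' : 0 < t <= T by rewrite t0.
have [v0 vr ar mr m2] := rates t n tT' Nn.
have v20 := em_var_gt0 b s0 t0 n0.
set r := C * t / n%:R in vr ar mr *.
have r0 : 0 <= r by rewrite divr_ge0// mulr_ge0 ?ltW.
rewrite em_error_gauss_op// !(eq_gauss_op _ _ mu_u mw wu).
set a1 := expR (b * t) in ar mr m2 *; set a2 := em_factor b t n in ar mr m2 *.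
set v1 := ou_var _ _ _ in v0 vr ar *; set v2 := em_var _ _ _ _ in v20 vr *.
have a10 : 0 < a1 by exact: expR_gt0.
have a20 : 0 < a2.
  by rewrite -(pmulr_lgt0 _ (_ : 0 < a1^-1)) ?invr_gt0//; apply: lt_le_trans m2.
have step1 : (\int[mu]_y (`|gauss_op a1 v1 w y - gauss_op a1 v2 w y|)%:E <=
    (3 * r)%:E * W)%E.
  have r30 : 0 <= 3 * r by exact: mulr_ge0.
  rewrite -(mul_cst_integral_norm r30 mw).
  apply: (gauss_opB_le (D := cst (3 * r))) => //.
    move=> x; apply: (le_trans (integral_gaussB_le _ _ v0 v20)).
    by rewrite subrr normr0 mul0r addr0 lee_fin ler_wpM2l.
  by rewrite [X in (X < _)%E](mul_cst_integral_norm r30 mw) -/W -(fineK Wfin) -EFinM ltry.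
have step2 : (\int[mu]_y (`|gauss_op a1 v2 w y - gauss_op a2 v2 w y|)%:E <=
    (2 * r)%:E * (W + G))%E.
  apply: le_trans (gauss_op_dilation_le v20 a10 a20 cw iw
    (measurable_upper_slope cw) (fun s => abse_ge0 _)
    (fun x y => increment_le_upper_slope acw (y := y))) _.
  apply: lee_wpmul2r; first exact: adde_ge0.
  have m0 : 0 < a2 / a1 by exact: divr_gt0.
  rewrite lee_fin ler_pdivrMr// distrC (le_trans mr)//.
  by rewrite -mulrA mulrCA ler_peMr//; lra.
have mK a v : 0 < v -> measurable_fun setT (gauss_op a v w).
  move=> v_gt0; have iK := integrable_gauss_op a v_gt0 iw.
  by move/measurable_int : iK => /measurable_EFinP.
have mKB a v a' v' : 0 < v -> 0 < v' ->
    measurable_fun setT (fun y => (`|gauss_op a v w y - gauss_op a' v' w y|)%:E).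
  move=> ? ?; apply/measurable_EFinP; apply: measurableT_comp => //.
  by apply: measurable_funB; exact: mK.
apply: (@le_trans _ _
  (\int[mu]_y (`|gauss_op a1 v1 w y - gauss_op a1 v2 w y|)%:E +
   \int[mu]_y (`|gauss_op a1 v2 w y - gauss_op a2 v2 w y|)%:E)%E).
  rewrite -ge0_integralD//; [|exact: mKB|exact: mKB].
  apply: ge0_le_integral => //; first exact: mKB.
    by apply: emeasurable_funD; exact: mKB.
  by move=> y _; rewrite -EFinD lee_fin ler_distD.
apply: (le_trans (leeD step1 step2)).
rewrite -(fineK Wfin) -(fineK Gfin) -(EFinD (fine W)) -!EFinM -EFinD lee_fin.
have -> : 3 * r * fine W + 2 * r * (fine W + fine G) = r * K by rewrite /K; ring.
have -> : (C * K + 1) * t / n%:R = r * K + t / n%:R by rewrite /r; ring.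
by rewrite lerDl divr_ge0// ltW.
Qed.

End rates.
End error_bounds.

Theorem proposition2p14 (R : realType) (b sigma T : R) (u0 : R -> R)
    (hsigma : sigma != 0) (hT : 0 < T)
    (hu0 : u0 \in Lfun (@lebesgue_measure R) 1%E) :
  (ereal_sup [set em_error b sigma u0 t n | t in `[0, T]]
     @[n --> \oo] --> 0%E) /\
  ((\int[@lebesgue_measure R]_x (`|x * u0 x|%:E) < +oo)%E \/
   (exists w : R -> R,
      [/\ {ae @lebesgue_measure R, forall x, w x = u0 x},
          locally_absolutely_continuous w &
          (\int[@lebesgue_measure R]_x (`|x * derive1 w x|%:E) < +oo)%E]) ->
   exists (C : R) (N : nat), [/\ 0 < C, (0 < N)%N &
     forall t : R, 0 <= t <= T -> forall n : nat, (N <= n)%N ->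
       (em_error b sigma u0 t n <= (C * t / n%:R)%:E)%E]).
Proof.
have iu : (@lebesgue_measure R).-integrable setT (EFin \o u0) by exact/Lfun1_integrable.
split; first exact: cvg_sup_em_error.
move=> [xu|[w [wu acw xw]]]; first exact: em_error_rate_moment.
exact: em_error_rate_AC wu acw xw.
Qed.
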